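(* Let $(M,g,(i,j,k))$ be a $3$-Sasaki manifold whose metric $g$ has signature $(4p-1,4q)$, and let $\nabla$ be the Levi-Civita connection of $g$. Then the tractor bundle $(\mathcal T,\nabla^{\mathcal T})$ of the induced projective manifold $(M,[\nabla])$ admits a parallel tractor hyperkähler structure of signature $(4p,4q)$, given by: (a) a parallel tractor metric $h\in\Gamma(S^2\mathcal T^* )$ of signature $(4p,4q)$ on $\mathcal T$, and (b) a triple $(\mathbb I,\mathbb J,\mathbb K)$ of parallel tractor complex structures $\mathbb I,\mathbb J,\mathbb K\in\Gamma(\operatorname{End}\mathcal T)$ on $\mathcal T$, each Hermitian with respect to $h$, and together satisfying $\mathbb I\mathbb J\mathbb K=-\mathrm{Id}_{\mathcal T}$.
   Context: All objects are smooth; metrics may be indefinite. **3-Sasaki.** A Sasaki structure on $M$ is a (pseudo-)Riemannian metric $g_{ab}$ with a Killing field $k^a$ such that $g_{ab}k^ak^b=1$ and $\nabla_a\nabla_bk^c=-g_{ab}k^c+\delta^c{}_ak_b$, with $\nabla$ the Levi-Civita connection and $k_b=g_{ab}k^a$. A $3$-Sasaki structure is a (pseudo-)Riemannian metric $g$ with three Killing fields $i,j,k$ such that each of $(g,i),(g,j),(g,k)$ is a Sasaki structure, $i,j,k$ are mutually $g$-orthogonal, and $[i,j]=-2k$, $[j,k]=-2i$, $[k,i]=-2j$. **Projective structures.** A projective structure $\mathbf p$ on a manifold $M$ of dimension $n+1\ge 2$ is an equivalence class of torsion-free affine connections having the same unparametrised geodesics; equivalently two members are related by $\widehat\nabla_a\xi^b=\nabla_a\xi^b+\Upsilon_a\xi^b+\delta^b{}_a\Upsilon_c\xi^c$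 for a $1$-form $\Upsilon_a$. $[\nabla]$ denotes the class of $\nabla$. For $\nabla\in\mathbf p$ with curvature $R_{ab}{}^c{}_d$ put $\operatorname{Ric}_{bd}=R_{cb}{}^c{}_d$ and $\mathsf P_{ab}=\frac1{n(n+2)}[(n+1)\operatorname{Ric}_{ab}+\operatorname{Ric}_{ba}]$. **Tractor bundle.** Let $\mathcal E(w)=\big((\Lambda^{n+1}TM)^{\otimes 2}\big)^{w/(2n+4)}$ (oriented roots) and $\mathcal V(w)=\mathcal V\otimes\mathcal E(w)$. The cotractor bundle is $\mathcal T^*=J^1\mathcal E(1)$ and the tractor bundle $\mathcal T$ (rank $n+2$) is its dual. There are exact sequences $0\to T^*M(1)\to\mathcal T^*\to\mathcal E(1)\to0$ and $0\to\mathcal E(-1)\to\mathcal T\to TM(-1)\to0$. A choice of $\nabla\in\mathbf p$ gives a linear connection on $\mathcal E(1)$ and hence splits these sequences; the projectively invariant tractor connection is, in this splitting, $\nabla^{\mathcal T}_a(\mu_b,\sigma)=(\nabla_a\mu_b+\mathsf P_{ab}\sigma,\ \nabla_a\sigma-\mu_a)$ on $\mathcal T^*$, and $\nabla^{\mathcal T}$ on $\mathcal T$ and tensor bundles is the induced connection. ''Parallel'' means $\nabla^{\mathcal T}$-parallel. A tractor metric is a nondegenerate symmetric section $h$ of $S^2\mathcal T^*$; a tractor complex structure is $\mathbb I\in\Gamma(\operatorname{End}\mathcal T)$ with $\mathbb I^2=-\mathrm{Id}_{\mathcal T}$; it is Hermitian with respect to $h$ if $h(\mathbb I\,\cdot,\mathbb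 I\,\cdot)=h$. *)

(* Defs.v *)
From HB Require Import structures.
From mathcomp Require Import all_boot all_order all_algebra.
From mathcomp Require Import all_classical all_reals all_analysis.

Set Implicit Arguments.
Unset Strict Implicit.
Unset Printing Implicit Defensive.

Import Order.TTheory GRing.Theory Num.Theory.
Import numFieldNormedType.Exports.

Local Open Scope classical_set_scope.
Local Open Scope ring_scope.

Section Calculus.
Variables (R : realType) (d : nat).
Implicit Types (U : set 'rV[R]_d) (a : 'I_d) (u : 'rV[R]_d).

Definition pd a (f : 'rV[R]_d -> R) u : R := 'D_(delta_mx 0 a) f u.

Definition pd_mx (r s : nat) a (F : 'rV[R]_d -> 'M[R]_(r, s)) u : 'M[R]_(r, s) :=
  \matrix_(b, c) pd a (fun v => F v b c) u.

(* Meant for open U. *)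
Fixpoint Ck_on (k : nat) U (f : 'rV[R]_d -> R) : Prop :=
  if k is l.+1 then
    (forall a u, U u -> derivable f u (delta_mx 0 a)) /\
    (forall a, Ck_on l U (pd a f))
  else forall u, U u -> {for u, continuous f}.

Definition smooth_on U (f : 'rV[R]_d -> R) : Prop := forall k, Ck_on k U f.

Definition smooth_mx_on (r s : nat) U (F : 'rV[R]_d -> 'M[R]_(r, s)) : Prop :=
  forall b c, smooth_on U (fun u => F u b c).

End Calculus.

Definition has_signature (R : realType) (m : nat) (S : 'M[R]_m) (p q : nat) : Prop :=
  (p + q)%N = m /\
  exists2 B : 'M[R]_m, B \in unitmx &
    B^T *m S *m B = diag_mx (\row_(a < m) (if (a < p)%N then 1 else - 1)).

(* A manifold is given by an atlas that need not be maximal; a tensor field on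
   the charts of an atlas extends uniquely to the maximal one. *)
Record smooth_manifold (R : realType) (d : nat) := SmoothManifold {
  carrier :> topologicalType;
  carrier_hausdorff : hausdorff_space carrier;
  carrier_second_countable : @second_countable carrier;
  chart : Type;
  dom : chart -> set carrier;
  coord : chart -> carrier -> 'rV[R]_d;
  param : chart -> 'rV[R]_d -> carrier;
  dom_open : forall i, open (dom i);
  dom_cover : forall x : carrier, exists i, dom i x;
  coord_open : forall i, open (coord i @` dom i);
  coordK : forall i x, dom i x -> param i (coord i x) = x;
  coord_continuous : forall i x, dom i x -> {for x, continuous (coord i)};
  param_continuous : forall i u, (coord i @` dom i) u ->
    {for u, continuous (param i)};
  transition_smooth : forall i j,
    smooth_mx_on (coord i @` (dom i `&` dom j)) (fun u => coord j (param i u))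
}.

Section Bundles.
Variables (R : realType) (d : nat) (M : smooth_manifold R d).
Implicit Types (i j : chart M) (a : 'I_d) (u : 'rV[R]_d).

Definition chart_image i : set 'rV[R]_d := coord i @` dom i.

Definition overlap i j : set 'rV[R]_d := coord i @` (dom i `&` dom j).

Definition transition i j u : 'rV[R]_d := coord j (param i u).

(* An object given in each chart, as a function of the coordinates; only its
   values on chart_image i are meaningful. *)
Definition local_field (V : Type) := chart M -> 'rV[R]_d -> V.

(* Vector bundles of rank r are given by transition matrices t i j u, acting on
   columns of components: s_j (transition i j u) = t i j u *m s_i u. *)
Definition cocycle (r : nat) := chart M -> chart M -> 'rV[R]_d -> 'M[R]_r.

Definition jacobian_mx i j u : 'M[R]_d :=
  \matrix_(b, a) pd a (fun v => transition i j v 0 b) u.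

Definition tangent_cocycle : cocycle d := jacobian_mx.

Definition dual_cocycle r (t : cocycle r) : cocycle r :=
  fun i j u => (invmx (t i j u))^T.

Definition smooth_field r s (F : local_field 'M[R]_(r, s)) : Prop :=
  forall i, smooth_mx_on (chart_image i) (F i).

Definition is_section r (t : cocycle r) (s : local_field 'cV[R]_r) : Prop :=
  smooth_field s /\
  forall i j u, overlap i j u -> s j (transition i j u) = t i j u *m s i u.

Definition is_bilinear_field r (t : cocycle r) (H : local_field 'M[R]_r) : Prop :=
  smooth_field H /\
  forall i j u, overlap i j u ->
    (t i j u)^T *m H j (transition i j u) *m t i j u = H i u.

Definition is_endomorphism_field r (t : cocycle r) (E : local_field 'M[R]_r) : Prop :=
  smooth_field E /\
  forall i j u, overlap i j u ->
    E j (transition i j u) *m t i j u = t i j u *m E i u.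

(* In each chart the covariant derivative is nabla_a s = pd_a s + eta_a *m s. *)
Definition connection_form (r : nat) := local_field ('I_d -> 'M[R]_r).

Definition is_connection r (t : cocycle r) (eta : connection_form r) : Prop :=
  (forall a, smooth_field (fun i u => eta i u a)) /\
  forall i j u a, overlap i j u ->
    pd_mx a (t i j) u +
      \sum_(e < d) jacobian_mx i j u e a *: (eta j (transition i j u) e *m t i j u)
    = t i j u *m eta i u a.

Definition dual_form r (eta : connection_form r) : connection_form r :=
  fun i u a => - (eta i u a)^T.

Definition curvature r (eta : connection_form r) i u a b : 'M[R]_r :=
  pd_mx a (fun v => eta i v b) u - pd_mx b (fun v => eta i v a) u
  + eta i u a *m eta i u b - eta i u b *m eta i u a.

Definition nabla_bilinear r (eta : connection_form r) (H : local_field 'M[R]_r)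
    i u a : 'M[R]_r :=
  pd_mx a (H i) u - (eta i u a)^T *m H i u - H i u *m eta i u a.

Definition nabla_endomorphism r (eta : connection_form r) (E : local_field 'M[R]_r)
    i u a : 'M[R]_r :=
  pd_mx a (E i) u + eta i u a *m E i u - E i u *m eta i u a.

(* Affine connections: (nabla i u a) c b is the Christoffel symbol
   Gamma_{ab}^c, so that nabla_a X^c = pd_a X^c + Gamma_{ab}^c X^b. *)
Definition is_affine_connection (nabla : connection_form d) : Prop :=
  is_connection tangent_cocycle nabla.

Definition torsion_free (nabla : connection_form d) : Prop :=
  forall i u a b c, chart_image i u -> nabla i u a c b = nabla i u b c a.

Definition is_vector_field (X : local_field 'cV[R]_d) : Prop :=
  is_section tangent_cocycle X.

Definition is_one_form (Upsilon : local_field 'cV[R]_d) : Prop :=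
  is_section (dual_cocycle tangent_cocycle) Upsilon.

Definition is_metric (g : local_field 'M[R]_d) : Prop :=
  is_bilinear_field tangent_cocycle g /\
  forall i u, chart_image i u -> (g i u)^T = g i u /\ g i u \in unitmx.

Definition field_has_signature r (H : local_field 'M[R]_r) (p q : nat) : Prop :=
  forall i u, chart_image i u -> has_signature (H i u) p q.

Definition is_levi_civita (g : local_field 'M[R]_d) (nabla : connection_form d) : Prop :=
  [/\ is_affine_connection nabla, torsion_free nabla &
      forall i u a, chart_image i u -> nabla_bilinear nabla g i u a = 0].

Definition inner (g : local_field 'M[R]_d) (X Y : local_field 'cV[R]_d) i u : R :=
  ((X i u)^T *m g i u *m Y i u) 0 0.

Definition flat (g : local_field 'M[R]_d) (X : local_field 'cV[R]_d) i u b : R :=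
  \sum_(a < d) g i u a b * X i u a 0.

Definition lie_derivative_bilinear (X : local_field 'cV[R]_d)
    (g : local_field 'M[R]_d) i u a b : R :=
  \sum_(c < d) (X i u c 0 * pd c (fun v => g i v a b) u
                + g i u c b * pd a (fun v => X i v c 0) u
                + g i u a c * pd b (fun v => X i v c 0) u).

Definition is_killing (g : local_field 'M[R]_d) (X : local_field 'cV[R]_d) : Prop :=
  is_vector_field X /\
  forall i u a b, chart_image i u -> lie_derivative_bilinear X g i u a b = 0.

Definition lie_bracket (X Y : local_field 'cV[R]_d) : local_field 'cV[R]_d :=
  fun i u => \col_(c < d) \sum_(a < d)
    (X i u a 0 * pd a (fun v => Y i v c 0) u
     - Y i u a 0 * pd a (fun v => X i v c 0) u).

(* nabla_b X^c *)
Definition nabla_vector (nabla : connection_form d) (X : local_field 'cV[R]_d)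
    i u b c : R :=
  pd b (fun v => X i v c 0) u + \sum_(e < d) nabla i u b c e * X i u e 0.

(* nabla_a nabla_b X^c *)
Definition nabla2_vector (nabla : connection_form d) (X : local_field 'cV[R]_d)
    i u a b c : R :=
  pd a (fun v => nabla_vector nabla X i v b c) u
  + \sum_(e < d) nabla i u a c e * nabla_vector nabla X i u b e
  - \sum_(e < d) nabla i u a e b * nabla_vector nabla X i u e c.

(* nabla is meant to be the Levi-Civita connection of g. *)
Record is_sasaki (g : local_field 'M[R]_d) (nabla : connection_form d)
    (k : local_field 'cV[R]_d) : Prop := IsSasaki {
  sasaki_metric : is_metric g;
  sasaki_killing : is_killing g k;
  sasaki_unit : forall i u, chart_image i u -> inner g k k i u = 1;
  sasaki_eq : forall i u a b c, chart_image i u ->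
    nabla2_vector nabla k i u a b c
    = - (g i u a b * k i u c 0) + (c == a)%:R * flat g k i u b
}.

Record is_3sasaki (g : local_field 'M[R]_d) (nabla : connection_form d)
    (X Y Z : local_field 'cV[R]_d) : Prop := Is3Sasaki {
  sasaki3_1 : is_sasaki g nabla X;
  sasaki3_2 : is_sasaki g nabla Y;
  sasaki3_3 : is_sasaki g nabla Z;
  sasaki3_orthogonal : forall i u, chart_image i u ->
    [/\ inner g X Y i u = 0, inner g Y Z i u = 0 & inner g Z X i u = 0];
  sasaki3_bracket : forall i u, chart_image i u ->
    [/\ lie_bracket X Y i u = - 2 *: Z i u,
        lie_bracket Y Z i u = - 2 *: X i u &
        lie_bracket Z X i u = - 2 *: Y i u]
}.

Definition projectively_equivalent (nabla nabla' : connection_form d) : Prop :=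
  exists2 Upsilon : local_field 'cV[R]_d, is_one_form Upsilon &
    forall i u a b c, chart_image i u ->
      nabla' i u a c b = nabla i u a c b + (c == b)%:R * Upsilon i u a 0
                         + (c == a)%:R * Upsilon i u b 0.

Definition projective_class (nabla : connection_form d) : set (connection_form d) :=
  [set nabla' | [/\ is_affine_connection nabla', torsion_free nabla' &
                    projectively_equivalent nabla nabla']].

Definition ricci (nabla : connection_form d) i u b e : R :=
  \sum_(c < d) curvature nabla i u c b c e.

End Bundles.

Section Tractors.
Variables (R : realType) (n : nat) (M : smooth_manifold R n.+1).
Implicit Types (i j : chart M) (a b c : 'I_n.+1) (u : 'rV[R]_n.+1).
Implicit Types (nabla : connection_form M n.+1) (P : set (connection_form M n.+1)).
Implicit Types (H E : local_field M 'M[R]_(1 + n.+1)).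

Definition schouten nabla i u a b : R :=
  ((n * (n + 2))%:R)^-1 * ((n + 1)%:R * ricci nabla i u a b + ricci nabla i u b a).

(* Transition functions of the density bundle E(w): components of sections of
   the top exterior power of TM are multiplied by det (jacobian_mx i j u). *)
Definition density_cocycle (w : R) i j u : R :=
  (\det (jacobian_mx i j u) ^+ 2) `^ (w / (2 * n + 4)%:R).

(* J^1 E(1): a 1-jet has components (sigma, pd_a sigma), and differentiating
   sigma_j (transition i j u) = rho u * sigma_i u gives
   J^T (pd sigma_j) = (pd rho) sigma_i + rho (pd sigma_i). *)
Definition cotractor_cocycle : cocycle M (1 + n.+1) := fun i j u =>
  let rho := density_cocycle 1 i j in
  let JT := (jacobian_mx i j u)^T in
  block_mx (rho u)%:M 0
           (invmx JT *m \col_a pd a rho u) (rho u *: invmx JT).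

Definition tractor_cocycle : cocycle M (1 + n.+1) := dual_cocycle cotractor_cocycle.

(* The connection induced on E(w); the connection induced on the top exterior
   power of TM, which is E(n + 2), has form the trace of nabla. *)
Definition density_form (w : R) nabla i u a : R :=
  w / (n + 2)%:R * \tr (nabla i u a).

(* The splitting of J^1 E(1) determined by nabla, in components:
   (sigma, pd_b sigma) |-> (sigma, mu_b) where mu_b = nabla_b sigma. *)
Definition splitting nabla i u : 'M[R]_(1 + n.+1) :=
  block_mx 1%:M 0 (\col_b density_form 1 nabla i u b) 1%:M.

(* (sigma, mu_b) |-> (nabla_a sigma - mu_a, nabla_a mu_b + P_ab sigma) *)
Definition split_cotractor_form nabla : connection_form M (1 + n.+1) :=
  fun i u a =>
    block_mx (density_form 1 nabla i u a)%:M
             (- delta_mx 0 a)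
             (\col_b schouten nabla i u a b)
             (dual_form nabla i u a + (density_form 1 nabla i u a)%:M).

(* The same connection, in the components (sigma, pd_b sigma). *)
Definition cotractor_form nabla : connection_form M (1 + n.+1) := fun i u a =>
  invmx (splitting nabla i u) *m
    (pd_mx a (splitting nabla i) u
     + split_cotractor_form nabla i u a *m splitting nabla i u).

Definition tractor_form nabla : connection_form M (1 + n.+1) :=
  dual_form (cotractor_form nabla).

(* The tractor connection of a projective structure P does not depend on the
   member of P used to compute it, so all of them may be required to kill H. *)
Definition parallel_bilinear P H : Prop :=
  forall nabla, P nabla -> forall i u a, chart_image i u ->
    nabla_bilinear (tractor_form nabla) H i u a = 0.

Definition parallel_endomorphism P E : Prop :=
  forall nabla, P nabla -> forall i u a, chart_image i u ->
    nabla_endomorphism (tractor_form nabla) E i u a = 0.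

Definition is_tractor_metric H : Prop :=
  is_bilinear_field tractor_cocycle H /\
  forall i u, chart_image i u -> (H i u)^T = H i u /\ H i u \in unitmx.

Definition is_tractor_complex_structure E : Prop :=
  is_endomorphism_field tractor_cocycle E /\
  forall i u, chart_image i u -> E i u *m E i u = - 1%:M.

Definition is_hermitian H E : Prop :=
  forall i u, chart_image i u -> (E i u)^T *m H i u *m E i u = H i u.

End Tractors.

(* Main.v *)
(** On a 3-Sasaki manifold, R + TM with the connection
    (rho, nu) |-> (pd_a rho - g_ab nu^b, nabla_a nu^b + rho delta_a^b) is the
    restriction of the tangent bundle of the metric cone. The cone metric
    rho^2 + g(nu, nu) is parallel, and the Sasaki equation says exactly that the
    endomorphism (rho, nu) |-> (- k.nu, rho k + nabla_nu k) is parallel. A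
    parallel endomorphism is determined by its value on the radial section
    (1, 0), since differentiating that section gives all of TM; so the
    quaternion relations follow from their values on (1, 0), where they are
    the normalisation, the orthogonality and the brackets of i, j, k.

    Hence the curvature of the cone commutes with a quaternionic structure, and
    the first Bianchi identity makes its Ricci contraction vanish: g is Einstein
    and the Schouten tensor is g itself. The cone connection is therefore the
    tractor connection of the Levi-Civita connection, once E(1) is trivialised
    by a power of the Riemannian volume density, and the tractor connection
    depends only on the projective class. *)

Require Import Defs.
From mathcomp Require Import all_boot all_order all_algebra.
From mathcomp Require Import all_classical all_reals all_analysis.
From mathcomp Require Import ring lra zify.

Set Implicit Arguments.
Unset Strict Implicit.
Unset Printing Implicit Defensive.

Import Order.TTheory GRing.Theory Num.Theory.
Import numFieldNormedType.Exports.
Local Open Scope classical_set_scope.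
Local Open Scope ring_scope.

(** * Partial derivatives *)

(** The passage from the cone to tractors goes through one matrix per chart, [frame]. It is built
    from [scale], a positive density with two properties: it transforms as a section of E(1), and it
    is parallel for the Levi-Civita connection. Hence [frame] satisfies a gauge equation between the
    two connections and intertwines the two cocycles, and statements on the cone are transported by
    matrix algebra. The derivative of the density cocycle, which enters the transition of 1-jets,
    comes from the same two properties. Ricci flatness is a symmetry argument: Bianchi and vanishing
    traces make [ricci *m E] symmetric for E = 1, I, J, K, and the quaternion relations then force
    [ricci *m K = - ricci *m K]. The contraction needs form indices and fibre indices of the same
    range, while the cone connection lives over M, one dimension short; so its curvature is extended
    by zero to the radial direction. The analytic input is the chain rule for chart changes and the
    symmetry of second partial derivatives, both drawn from the mean value theorem along coordinate
    directions. *)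

Section LineMVT.
Variables (R : realType) (V : normedModType R).
Implicit Types (f : V -> R) (x v : V).

Lemma is_derive_line f x v (t : R) : derivable f (x + t *: v) v ->
  is_derive t (1 : R) (fun s : R => f (x + s *: v)) ('D_v f (x + t *: v)).
Proof.
move=> df.
have E : (fun h : R => h^-1 *: (((fun s : R => f (x + s *: v)) \o shift t) (h *: 1)
    - f (x + t *: v))) =
  (fun h : R => h^-1 *: ((f \o shift (x + t *: v)) (h *: v) - f (x + t *: v))).
  apply/funext => h /=; congr (_ *: (f _ - _)).
  by rewrite [h%:A]mulr1 scalerDl addrCA.
by split; rewrite /derivable /derive E.
Qed.

Lemma mvt_line f x v (c : R) :
  (forall t : R, `|t| <= `|c| -> derivable f (x + t *: v) v) ->
  exists2 t : R, `|t| <= `|c| &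
    f (x + c *: v) - f x = c * 'D_v f (x + t *: v).
Proof.
have pos (y : V) (s : R) : 0 <= s ->
    (forall t : R, 0 <= t <= s -> derivable f (y + t *: v) v) ->
    exists2 t : R, 0 <= t <= s & f (y + s *: v) - f y = s * 'D_v f (y + t *: v).
  move=> s0 df; pose phi t := f (y + t *: v).
  have dphi (t : R) : 0 <= t <= s -> is_derive t 1 phi ('D_v f (y + t *: v)).
    by move=> ts; apply: is_derive_line; apply: df.
  have [t|t|t ts E] := @MVT_segment _ phi (fun t => 'D_v f (y + t *: v)) 0 s s0.
  - by rewrite in_itv/= => /andP[t0 ts]; apply: dphi; rewrite !ltW.
  - apply: derivable_within_continuous => z; rewrite in_itv/= => zs.
    by have [] := dphi z zs.
  exists t; first by move: ts; rewrite in_itv.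
  by move: E; rewrite /phi scale0r addr0 subr0 mulrC.
move=> df; have [c0|c0] := leP 0 c.
  have [t|t /andP[t0 tc] E] := pos x c c0.
    by move=> /andP[t0 tc]; apply: df; rewrite !ger0_norm.
  by exists t => //; rewrite !ger0_norm.
(* For [c < 0] the segment is run from its other end, with positive length [- c]. *)
have [||t /andP[t0 tc] E] := pos (x + c *: v) (- c).
- by rewrite oppr_ge0 ltW.
- move=> t /andP[t0 tc]; rewrite -addrA -scalerDl; apply: df.
  by rewrite (ltr0_norm c0) ler0_norm; lra.
exists (c + t).
  by rewrite (ltr0_norm c0) ler0_norm; lra.
move: E; rewrite -!addrA -!scalerDl subrr scale0r addr0 => E.
by apply: oppr_inj; rewrite opprB E mulNr.
Qed.

End LineMVT.

Section Partial.
Variables (R : realType) (d : nat).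
Implicit Types (U : set 'rV[R]_d) (f g : 'rV[R]_d -> R) (u h : 'rV[R]_d).
Implicit Types (a b : 'I_d).

Lemma row_norm_le u (r : R) : 0 <= r -> (forall a, `|u 0 a| <= r) -> `|u| <= r.
Proof.
move=> r0 ur; rewrite /Num.Def.normr/= mx_normrE.
by apply: bigmax_le => // -[i a] _ /=; rewrite (ord1 i).
Qed.

Lemma row_coord_le u a : `|u 0 a| <= `|u|.
Proof.
rewrite [leRHS]/Num.Def.normr/= mx_normrE.
exact: (le_bigmax _ (fun ij => `|u ij.1 ij.2|) (0, a)).
Qed.

Lemma open_normP U u : open U -> U u ->
  exists2 r : R, 0 < r & forall h, `|h| < r -> U (u + h).
Proof.
move=> oU Uu; have /nbhs_ballP[r r0 rU] : nbhs u U by exact: open_nbhs_nbhs.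
exists r => // h hr; apply: rU; rewrite -ball_normE /= opprD addrA subrr.
by rewrite add0r normrN.
Qed.

Definition C1_on U f : Prop := forall a,
  (forall u, U u -> derivable f u (delta_mx 0 a)) /\
  (forall u, U u -> {for u, continuous (pd a f)}).

(** Changing one coordinate at a time splits the increment into d one-variable increments, each
    given by the mean value theorem. The intermediate points stay within [|h|] of [u] because the
    norm is the maximum norm. *)
Lemma increment_sum U f u (r : R) :
  (forall h, `|h| < r -> U (u + h)) -> C1_on U f ->
  forall h, `|h| < r -> exists xi : 'I_d -> 'rV[R]_d,
    (forall a, `|xi a| <= `|h|) /\
    f (u + h) - f u = \sum_a h 0 a * pd a f (u + xi a).
Proof.
move=> rU fC1 h hr.
(* The path from [0 = trunc 0] to [h = trunc d] that switches on the coordinates of [h] in order. *)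
pose trunc (m : nat) : 'rV[R]_d := \row_a (if (a < m)%N then h 0 a else 0).
have truncS a : trunc a.+1 = trunc a + h 0 a *: delta_mx 0 a.
  apply/rowP => b; rewrite !mxE eqxx /= ltnS leq_eqVlt.
  rewrite -[(b : nat) == a]/(b == a); case: (eqVneq b a) => [->|_] /=.
    by rewrite ltnn mulr1 add0r.
  by rewrite mulr0 addr0.
have seg a (t : R) : `|t| <= `|h 0 a| -> `|trunc a + t *: delta_mx 0 a| <= `|h|.
  move=> th; apply: row_norm_le => // b; rewrite !mxE eqxx /=.
  case: (eqVneq b a) => [->|ba].
    by rewrite ltnn add0r mulr1 (le_trans th)// row_coord_le.
  rewrite mulr0 addr0; case: ifP => _; first exact: row_coord_le.
  by rewrite normr0.
have /choice[xi xiP] a : exists x : 'rV[R]_d, `|x| <= `|h| /\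
    f (u + trunc a.+1) - f (u + trunc a) = h 0 a * pd a f (u + x).
  have [t th|t th E] := @mvt_line _ _ f (u + trunc a) (delta_mx 0 a) (h 0 a).
    have [df _] := fC1 a; rewrite -addrA; apply: df; apply: rU.
    by apply: le_lt_trans hr; exact: seg.
  exists (trunc a + t *: delta_mx 0 a); split; first exact: seg.
  by rewrite truncS !addrA E.
exists xi; split=> [a|]; first exact: (xiP a).1.
have -> : f (u + h) - f u = f (u + trunc d) - f (u + trunc 0%N).
  rewrite [trunc 0%N](_ : _ = 0) ?addr0; last by apply/rowP => a; rewrite !mxE.
  by congr (f (u + _) - _); apply/rowP => a; rewrite mxE ltn_ord.
rewrite -(telescope_sumr (fun m => f (u + trunc m)))// big_mkord.
by apply: eq_bigr => a _; exact: (xiP a).2.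
Qed.

(** The increment formula is applied to [h s], the increment of [gam]; its evaluation points tend to
    [gam x] with [s], so continuity of the partial derivatives gives the limit of the difference
    quotient. *)
Lemma is_derive_comp_C1 (V : normedModType R) U f (gam : V -> 'rV[R]_d) (x v : V) :
  open U -> U (gam x) -> C1_on U f -> derivable gam x v ->
  is_derive x v (f \o gam) (\sum_a ('D_v gam x) 0 a * pd a f (gam x)).
Proof.
move=> oU Ux fC1 dg; have [r r0 rU] := open_normP oU Ux.
pose h (s : R) := gam (s *: v + x) - gam x.
have dh : s^-1 *: h s @[s --> 0^'] --> 'D_v gam x by exact: dg.
have h0 : h s @[s --> 0^'] --> (0 : 'rV[R]_d).
  have : s *: (s^-1 *: h s) @[s --> 0^'] --> (0 : R) *: 'D_v gam x.
    apply: cvgZ => //; exact: nbhs_dnbhs.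
  rewrite scale0r; apply: cvg_trans; apply: near_eq_cvg.
  near=> s; rewrite scalerA divff ?scale1r//.
  by near: s; exact: nbhs_dnbhs_neq.
(* Outside the ball [xi] is set to 0, so that its bound by [|h s|] holds for every [s] and only the
   increment formula is conditional. *)
have /choice[xi xiP] s : exists xi : 'I_d -> 'rV[R]_d, (forall a, `|xi a| <= `|h s|) /\
    (`|h s| < r -> f (gam x + h s) - f (gam x) =
       \sum_a (h s) 0 a * pd a f (gam x + xi a)).
  have [hr|hr] := pselect (`|h s| < r); last first.
    by exists (fun=> 0); split=> // a; rewrite normr0.
  by have [xi [xi1 xi2]] := increment_sum rU fC1 hr; exists xi.
have lim : s^-1 *: (f (gam (s *: v + x)) - f (gam x)) @[s --> 0^'] -->
    \sum_a ('D_v gam x) 0 a * pd a f (gam x).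
  have : \sum_a (s^-1 *: h s) 0 a * pd a f (gam x + xi s a) @[s --> 0^'] -->
      \sum_a ('D_v gam x) 0 a * pd a f (gam x).
    apply: cvg_big => [|a _]; first exact: add_continuous.
    apply: cvgM.
      exact: (continuous_cvg _ (@coord_continuous _ _ _ 0 a _) dh).
    apply: (@cvg_comp _ _ _ (fun s => gam x + xi s a) (pd a f) _ (nbhs (gam x)));
      last by have [_ cf] := fC1 a; exact: cf.
    suff xi0 : xi s a @[s --> 0^'] --> (0 : 'rV[R]_d).
      by have := cvgD (cvg_cst (gam x)) xi0; rewrite addr0; exact.
    apply/cvgrPdist_le => e e0; near=> s; rewrite sub0r normrN.
    apply: le_trans ((xiP s).1 a) _.
    rewrite -normrN -sub0r; near: s; move/cvgrPdist_le: h0; exact.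
  apply: cvg_trans; apply: near_eq_cvg; near=> s.
  have -> : gam (s *: v + x) = gam x + h s by rewrite /h [RHS]addrC subrK.
  rewrite (xiP s).2; last first.
    rewrite -normrN -sub0r; near: s; move/cvgrPdist_lt: h0; exact.
  rewrite scaler_sumr; apply: eq_bigr => a _.
  by rewrite mxE -mulrA.
split; first by apply/cvg_ex; eexists; exact: lim.
exact: cvg_lim lim.
Unshelve. all: by end_near. Qed.

End Partial.

(** * Smooth functions and the symmetry of second partial derivatives *)

Section Smooth.
Variables (R : realType) (d : nat).
Variables (U : set 'rV[R]_d) (oU : open U).
Implicit Types (f g : 'rV[R]_d -> R) (u h : 'rV[R]_d).
Implicit Types (a b : 'I_d) (k : nat).

Lemma near_eq_on (T : Type) (f g : 'rV[R]_d -> T) u :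
  U u -> (forall v, U v -> f v = g v) -> {near u, f =1 g}.
Proof.
move=> Uu fg; apply: filterS (open_nbhs_nbhs (conj oU Uu)) => v Uv.
exact: fg.
Qed.

Lemma pd_eq_on f g a u : U u -> (forall v, U v -> f v = g v) ->
  pd a f u = pd a g u.
Proof. by move=> Uu fg; apply: near_eq_derive; exact: near_eq_on fg. Qed.

Lemma Ck_on_eq k f g : (forall v, U v -> f v = g v) ->
  Ck_on k U f -> Ck_on k U g.
Proof.
elim: k f g => [|k IH] f g fg /=.
  move=> cf u Uu; have nfg := near_eq_on Uu fg.
  rewrite /prop_for /continuous_at -(fg _ Uu); apply: cvg_trans (cf u Uu).
  exact: near_eq_cvg nfg.
move=> [df Cf]; split=> [a u Uu|a].
  exact: near_eq_derivable (near_eq_on Uu fg) (df a u Uu).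
by apply: IH (Cf a) => u Uu; exact: pd_eq_on.
Qed.

Lemma smooth_on_eq f g : (forall v, U v -> f v = g v) ->
  smooth_on U f -> smooth_on U g.
Proof. by move=> fg Cf k; exact: Ck_on_eq fg (Cf k). Qed.

Lemma smooth_on_derivable f a u :
  smooth_on U f -> U u -> derivable f u (delta_mx 0 a).
Proof. by move=> Cf Uu; have [df _] := Cf 1%N; exact: df. Qed.

Lemma smooth_on_pd f a : smooth_on U f -> smooth_on U (pd a f).
Proof. by move=> Cf k; have [_ ] := Cf k.+1; exact. Qed.

Lemma smooth_on_C1 f : smooth_on U f -> C1_on U f.
Proof.
move=> Cf a; split=> u Uu; first exact: smooth_on_derivable.
exact: (smooth_on_pd a Cf 0%N).
Qed.

Lemma pdD f g a u : smooth_on U f -> smooth_on U g -> U u ->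
  pd a (f \+ g) u = pd a f u + pd a g u.
Proof. by move=> *; apply: deriveD; exact: smooth_on_derivable. Qed.

Lemma pdN f a u : smooth_on U f -> U u -> pd a (\- f) u = - pd a f u.
Proof. by move=> *; apply: deriveN; exact: smooth_on_derivable. Qed.

Lemma pdM f g a u : smooth_on U f -> smooth_on U g -> U u ->
  pd a (f \* g) u = pd a f u * g u + f u * pd a g u.
Proof.
move=> Cf Cg Uu; rewrite [LHS]deriveM; try exact: smooth_on_derivable.
by rewrite addrC [g u *: _]mulrC.
Qed.

Lemma pd_cst (c : R) a u : pd a (cst c) u = 0.
Proof. exact: derive_cst. Qed.

Lemma Ck_on_cst k (c : R) : Ck_on k U (cst c).
Proof.
elim: k c => [|k IH] c /=; first by move=> u _; exact: cst_continuous.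
split=> [a u _|a]; first exact: derivable_cst.
by apply: Ck_on_eq (IH 0) => u _; rewrite pd_cst.
Qed.

Lemma smooth_on_cst (c : R) : smooth_on U (cst c).
Proof. by move=> k; exact: Ck_on_cst. Qed.

Lemma Ck_onD k f g : Ck_on k U f -> Ck_on k U g -> Ck_on k U (f \+ g).
Proof.
elim: k f g => [|k IH] f g /=.
  by move=> cf cg u Uu; apply: continuousD; [exact: cf|exact: cg].
move=> [df Cf] [dg Cg]; split=> [a u Uu|a].
  by apply: derivableD; [exact: df|exact: dg].
apply: Ck_on_eq (IH _ _ (Cf a) (Cg a)) => u Uu; apply/esym.
by apply: deriveD; [exact: df|exact: dg].
Qed.

Lemma smooth_onD f g : smooth_on U f -> smooth_on U g -> smooth_on U (f \+ g).
Proof. by move=> Cf Cg k; exact: Ck_onD. Qed.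

Lemma smooth_onM f g : smooth_on U f -> smooth_on U g -> smooth_on U (f \* g).
Proof.
move=> Cf Cg k; elim: k f g Cf Cg => [|k IH] f g Cf Cg /=.
  by move=> u Uu; apply: continuousM; [exact: (Cf 0%N)|exact: (Cg 0%N)].
split=> [a u Uu|a]; first by apply: derivableM; exact: smooth_on_derivable.
apply: (@Ck_on_eq _ ((pd a f \* g) \+ (f \* pd a g))).
  by move=> u Uu; rewrite pdM.
by apply: Ck_onD; apply: IH => //; exact: smooth_on_pd.
Qed.

Lemma smooth_onN f : smooth_on U f -> smooth_on U (\- f).
Proof.
move=> Cf; apply: smooth_on_eq (smooth_onM (smooth_on_cst (- 1)) Cf) => u _ /=.
by rewrite mulN1r.
Qed.

Lemma smooth_on_sum (I : Type) (r : seq I) (F : I -> 'rV[R]_d -> R) :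
  (forall i, smooth_on U (F i)) -> smooth_on U (fun u => \sum_(i <- r) F i u).
Proof.
move=> CF; elim: r => [|i r IH].
  by apply: smooth_on_eq (smooth_on_cst 0) => u _; rewrite big_nil.
by apply: smooth_on_eq (smooth_onD (CF i) IH) => u _; rewrite big_cons.
Qed.

Lemma pd_sum (I : Type) (r : seq I) (F : I -> 'rV[R]_d -> R) a u :
  (forall i, smooth_on U (F i)) -> U u ->
  pd a (fun u => \sum_(i <- r) F i u) u = \sum_(i <- r) pd a (F i) u.
Proof.
move=> CF Uu; elim: r => [|i r IH].
  rewrite big_nil -[RHS](pd_cst 0 a u).
  by apply: pd_eq_on => // v _; rewrite big_nil.
rewrite big_cons -IH -pdD//; last exact: smooth_on_sum.
by apply: pd_eq_on => // v _; rewrite big_cons.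
Qed.

(** The left side is the second difference of [f] over a square of side [s]. It is the increment in
    direction [a] of [G], itself an increment in direction [b]; the mean value theorem is used once
    in each direction. *)
Lemma second_increment f a b u (r s : R) : smooth_on U f ->
  (forall h, `|h| < r -> U (u + h)) -> 0 < s -> s + s < r ->
  exists2 h, `|h| <= s + s &
    f (u + s *: delta_mx 0 a + s *: delta_mx 0 b) - f (u + s *: delta_mx 0 b)
      - (f (u + s *: delta_mx 0 a) - f u)
    = s * (s * pd b (pd a f) (u + h)).
Proof.
move=> Cf rU s0 sr.
have n1 (t : R) (c : 'I_d) : `|t *: (delta_mx 0 c : 'rV[R]_d)| <= `|t|.
  apply: row_norm_le => // e; rewrite !mxE eqxx /=.
  by case: eqP; rewrite ?mulr1 ?mulr0 ?normr0.
have n2 (t t' : R) : `|t| <= s -> `|t'| <= s ->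
    `|t *: (delta_mx 0 a : 'rV[R]_d) + t' *: delta_mx 0 b| <= s + s.
  by move=> ts t's; rewrite (le_trans (ler_normD _ _))// lerD// (le_trans (n1 _ _)).
have inU (t t' : R) : `|t| <= s -> `|t'| <= s ->
    U (u + t *: (delta_mx 0 a : 'rV[R]_d) + t' *: delta_mx 0 b).
  by move=> ts t's; rewrite -addrA; apply: rU; exact: le_lt_trans (n2 _ _ ts t's) sr.
have ss : `|s| <= s by rewrite gtr0_norm.
have z0 : `|0 : R| <= s by rewrite normr0 ltW.
pose G (v : 'rV[R]_d) := f (v + s *: delta_mx 0 b) - f v.
have dsh (v : 'rV[R]_d) : U (v + s *: delta_mx 0 b) ->
    is_derive v (delta_mx 0 a : 'rV[R]_d) (fun v => f (v + s *: delta_mx 0 b))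
      (pd a f (v + s *: delta_mx 0 b)).
  move=> Uv; have df := smooth_on_derivable (a := a) Cf Uv.
  have E : (fun h : R => h^-1 *: (((fun v => f (v + s *: delta_mx 0 b)) \o shift v)
      (h *: delta_mx 0 a) - f (v + s *: delta_mx 0 b))) =
    (fun h : R => h^-1 *: ((f \o shift (v + s *: delta_mx 0 b)) (h *: delta_mx 0 a)
      - f (v + s *: delta_mx 0 b))).
    by apply/funext => h /=; rewrite addrA.
  by split; rewrite /derivable /derive E.
have dG (v : 'rV[R]_d) : U v -> U (v + s *: delta_mx 0 b) ->
    is_derive v (delta_mx 0 a : 'rV[R]_d) G
      (pd a f (v + s *: delta_mx 0 b) - pd a f v).
  move=> Uv Uv'; have := dsh v Uv' => dv.
  by apply: is_deriveB; apply: derivableP; exact: smooth_on_derivable.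
have [t ts|t ts EG] := @mvt_line _ _ G u (delta_mx 0 a) s.
  rewrite (gtr0_norm s0) in ts.
  have := inU t 0 ts z0; rewrite scale0r addr0 => U1.
  by have [] := dG _ U1 (inU t s ts ss).
rewrite (gtr0_norm s0) in ts.
have U1 := inU t 0 ts z0; rewrite scale0r addr0 in U1.
have [_ dGE] := dG _ U1 (inU t s ts ss).
have [t' t's|t' t's E'] := @mvt_line _ _ (pd a f) (u + t *: delta_mx 0 a) (delta_mx 0 b) s.
  rewrite (gtr0_norm s0) in t's.
  by apply: smooth_on_derivable; [exact: smooth_on_pd|exact: inU].
rewrite (gtr0_norm s0) in t's.
exists (t *: delta_mx 0 a + t' *: delta_mx 0 b); first exact: n2.
by move: EG; rewrite dGE E' /G [u + (_ + _)]addrA => <-; ring.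
Qed.

(** The second difference is symmetric in [a] and [b], so on arbitrarily small squares the two mixed
    derivatives agree at two nearby points; both being continuous at [u], they agree there. *)
Lemma pd_comm f a b u : smooth_on U f -> U u ->
  pd a (pd b f) u = pd b (pd a f) u.
Proof.
have quarter (x : R) : 0 < x -> x / 4 + x / 4 < x by lra.
have tri (x y z e : R) : `|x - z| < e -> `|y - z| < e -> `|x - y| < e + e.
  move=> xz yz; rewrite -(subrKA z) (le_lt_trans (ler_normD _ _))// ltrD//.
  by rewrite distrC.
move=> Cf Uu; apply/eqP/contraT => ne.
(* Half of the supposed gap: two deviations below [e] cannot add up to it. *)
pose e := `|pd a (pd b f) u - pd b (pd a f) u| / 2.
have e0 : 0 < e by rewrite divr_gt0// normr_gt0 subr_eq0.
have near_pd (c c' : 'I_d) : exists2 r : R, 0 < r &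
    forall h, `|h| < r -> `|pd c (pd c' f) u - pd c (pd c' f) (u + h)| < e.
  have cf : {for u, continuous (pd c (pd c' f))}.
    exact: (smooth_on_pd c (smooth_on_pd c' Cf) 0%N).
  move/cvgrPdist_lt: cf => /(_ _ e0)/nbhs_ballP[r r0 rE].
  exists r => // h hr; apply: rE; rewrite -ball_normE /= opprD addrA subrr.
  by rewrite add0r normrN.
have [r0 r00 r0U] := open_normP oU Uu.
have [r1 r10 r1E] := near_pd a b; have [r2 r20 r2E] := near_pd b a.
pose r := Num.min r0 (Num.min r1 r2).
have rr : 0 < r by rewrite !lt_min r00 r10.
have [s s0 ssr] : exists2 s : R, 0 < s & s + s < r.
  by exists (r / 4); [rewrite divr_gt0|exact: quarter].
have : s + s < r := ssr; rewrite !lt_min => /and3P[sr0 sr1 sr2].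
have [h1 h1s E1] := second_increment a b Cf r0U s0 sr0.
have [h2 h2s E2] := second_increment b a Cf r0U s0 sr0.
have E : pd b (pd a f) (u + h1) = pd a (pd b f) (u + h2).
  have s2 : s != 0 by rewrite gt_eqF.
  suff : s * (s * pd b (pd a f) (u + h1)) = s * (s * pd a (pd b f) (u + h2)).
    by move=> /(mulfI s2)/(mulfI s2).
  apply: (etrans (esym E1)); apply: (etrans _ E2).
  have -> : u + s *: delta_mx 0 b + s *: delta_mx 0 a =
     u + s *: delta_mx 0 a + s *: delta_mx 0 b by rewrite addrAC.
  by ring.
have l1 := r1E h2 (le_lt_trans h2s sr1).
have l2 := r2E h1 (le_lt_trans h1s sr2).
rewrite E in l2.
by have := tri _ _ _ _ l1 l2; rewrite /e -splitr ltxx.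
Qed.

End Smooth.

(** * Calculus of matrix-valued functions *)

Section MatrixCalculus.
Variables (R : realType) (d : nat).
Variables (U : set 'rV[R]_d) (oU : open U).
Implicit Types (s : 'rV[R]_d -> R) (u : 'rV[R]_d) (a b : 'I_d).

Lemma smooth_on_prod (I : Type) (r : seq I) (F : I -> 'rV[R]_d -> R) :
  (forall i, smooth_on U (F i)) -> smooth_on U (fun u => \prod_(i <- r) F i u).
Proof.
move=> CF; elim: r => [|i r IH].
  by apply: smooth_on_eq (smooth_on_cst oU 1) => // u _; rewrite big_nil.
apply: (smooth_on_eq oU) (smooth_onM oU (CF i) IH) => u _.
by rewrite big_cons.
Qed.

Lemma pd_prod n (F : 'I_n -> 'rV[R]_d -> R) a u :
  (forall i, smooth_on U (F i)) -> U u ->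
  pd a (fun v => \prod_(i < n) F i v) u
  = \sum_(k < n) pd a (F k) u * \prod_(i < n | i != k) F i u.
Proof.
move=> CF Uu; elim: n F CF => [|n IH] F CF.
  rewrite big_ord0 -[RHS](pd_cst 1 a u).
  by apply: (pd_eq_on oU) => // v _; rewrite big_ord0.
rewrite (pd_eq_on oU (g := F ord0 \* (fun v => \prod_(i < n) F (lift ord0 i) v)))//;
  last by move=> v _; rewrite big_ord_recl.
rewrite (pdM (U := U))//; last exact: smooth_on_prod.
rewrite IH// big_ord_recl; congr (_ + _).
  by rewrite [in RHS]big_mkcond big_ord_recl /= mul1r.
rewrite mulr_sumr; apply: eq_bigr => k _.
rewrite [in RHS]big_mkcond big_ord_recl /= mulrCA; congr (_ * (_ * _)).
by rewrite [LHS]big_mkcond; apply: eq_bigr => i _; rewrite (inj_eq lift_inj).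
Qed.

Lemma smooth_on_det n (F : 'rV[R]_d -> 'M[R]_n) :
  smooth_mx_on U F -> smooth_on U (fun u => \det (F u)).
Proof.
move=> CF; apply: (smooth_on_sum oU) => s.
apply: (smooth_onM oU); first exact: smooth_on_cst.
by apply: smooth_on_prod => i; exact: CF.
Qed.

(** Jacobi's formula. The derivative is the sum over [k] of the determinants with row [k]
    differentiated, and expanding such a determinant along row [k] gives the k-th diagonal entry of
    the product with the adjugate. *)
Lemma pd_det n (F : 'rV[R]_d -> 'M[R]_n) a u : smooth_mx_on U F -> U u ->
  pd a (fun v => \det (F v)) u = \tr (pd_mx a F u *m \adj (F u)).
Proof.
move=> CF Uu; rewrite [LHS](pd_sum oU)//; last first.
  move=> s; apply: (smooth_onM oU); first exact: smooth_on_cst.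
  by apply: smooth_on_prod => i; exact: CF.
pose G k : 'M[R]_n := \matrix_(i, j) if i == k then pd_mx a F u i j else F u i j.
transitivity (\sum_k \det (G k)); last first.
  apply: eq_bigr => k _; rewrite (expand_det_row _ k) mxE.
  apply: eq_bigr => j _; rewrite !mxE eqxx; congr (_ * _).
  rewrite /cofactor; congr (_ * \det _); apply/matrixP => i l.
  by rewrite !mxE eq_sym (negPf (neq_lift k i)).
rewrite exchange_big /=; apply: eq_bigr => s _.
rewrite (pdM (U := U) (f := cst _))//; last first.
- by apply: smooth_on_prod => i; exact: CF.
- exact: smooth_on_cst.
rewrite pd_cst mul0r add0r /= -mulr_sumr; congr (_ * _).
rewrite (pd_prod _ (fun i => CF i _))//; apply: eq_bigr => k _.
rewrite [in RHS](bigD1 k)//= !mxE eqxx; congr (_ * _).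
by apply: eq_bigr => i /negPf ik; rewrite mxE ik.
Qed.

Section Mx.
Variables (m n p : nat).
Implicit Types (F G : 'rV[R]_d -> 'M[R]_(m, n)) (H : 'rV[R]_d -> 'M[R]_(n, p)).

Lemma pd_mx_eq_on F G a u : U u -> (forall v, U v -> F v = G v) ->
  pd_mx a F u = pd_mx a G u.
Proof.
move=> Uu FG; apply/matrixP => i j; rewrite !mxE.
by apply: (pd_eq_on oU) => // v Uv; rewrite FG.
Qed.

Lemma smooth_mx_cst (A : 'M[R]_(m, n)) : smooth_mx_on U (fun=> A).
Proof. by move=> i j; exact: smooth_on_cst. Qed.

Lemma pd_mx_cst (A : 'M[R]_(m, n)) a u : pd_mx a (fun=> A) u = 0.
Proof. by apply/matrixP => i j; rewrite !mxE; exact: pd_cst. Qed.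

Lemma smooth_mxD F G : smooth_mx_on U F -> smooth_mx_on U G ->
  smooth_mx_on U (fun u => F u + G u).
Proof.
move=> CF CG i j; apply: (smooth_on_eq oU) (smooth_onD oU (CF i j) (CG i j)).
by move=> v _; rewrite mxE.
Qed.

Lemma pd_mxD F G a u : smooth_mx_on U F -> smooth_mx_on U G -> U u ->
  pd_mx a (fun v => F v + G v) u = pd_mx a F u + pd_mx a G u.
Proof.
move=> CF CG Uu; apply/matrixP => i j; rewrite !mxE -(pdD (U := U))//.
by apply: (pd_eq_on oU) => // v _; rewrite mxE.
Qed.

Lemma smooth_mxN F : smooth_mx_on U F -> smooth_mx_on U (fun u => - F u).
Proof.
move=> CF i j; apply: (smooth_on_eq oU) (smooth_onN oU (CF i j)).
by move=> v _; rewrite mxE.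
Qed.

Lemma pd_mxN F a u : smooth_mx_on U F -> U u ->
  pd_mx a (fun v => - F v) u = - pd_mx a F u.
Proof.
move=> CF Uu; apply/matrixP => i j; rewrite !mxE -(pdN (U := U))//.
by apply: (pd_eq_on oU) => // v _; rewrite mxE.
Qed.

Lemma smooth_mxZ s F : smooth_on U s -> smooth_mx_on U F ->
  smooth_mx_on U (fun u => s u *: F u).
Proof.
move=> Cs CF i j; apply: (smooth_on_eq oU) (smooth_onM oU Cs (CF i j)).
by move=> v _; rewrite mxE.
Qed.

Lemma smooth_mxM F H : smooth_mx_on U F -> smooth_mx_on U H ->
  smooth_mx_on U (fun u => F u *m H u).
Proof.
move=> CF CH i j.
apply: (smooth_on_eq oU) (smooth_on_sum oU (index_enum _)
  (fun l => smooth_onM oU (CF i l) (CH l j))).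
by move=> v _; rewrite mxE.
Qed.

Lemma pd_mxM F H a u : smooth_mx_on U F -> smooth_mx_on U H -> U u ->
  pd_mx a (fun v => F v *m H v) u = pd_mx a F u *m H u + F u *m pd_mx a H u.
Proof.
move=> CF CH Uu; apply/matrixP => i j; rewrite !mxE -big_split /=.
rewrite (pd_eq_on oU
  (g := fun v => \sum_l ((fun w => F w i l) \* (fun w => H w l j)) v))//;
  last by move=> v _; rewrite mxE.
rewrite (pd_sum oU)//; last by move=> l; exact: (smooth_onM oU).
by apply: eq_bigr => l _; rewrite (pdM (U := U))// !mxE.
Qed.

Lemma smooth_mx_tr F : smooth_mx_on U F -> smooth_mx_on U (fun u => (F u)^T).
Proof.
move=> CF i j; apply: (smooth_on_eq oU) (CF j i) => v _.
by rewrite mxE.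
Qed.

Lemma pd_mx_tr F a u : pd_mx a (fun v => (F v)^T) u = (pd_mx a F u)^T.
Proof.
apply/matrixP => i j; rewrite !mxE; congr pd.
by apply/funext => v; rewrite mxE.
Qed.

Lemma pd_mx_comm F a b u : smooth_mx_on U F -> U u ->
  pd_mx a (pd_mx b F) u = pd_mx b (pd_mx a F) u.
Proof.
move=> CF Uu; apply/matrixP => i j; rewrite [LHS]mxE [RHS]mxE.
have E c : (fun v => pd_mx c F v i j) = pd c (fun v => F v i j).
  by apply/funext => v; rewrite mxE.
by have := pd_comm oU a b (CF i j) Uu; rewrite -(E a) -(E b).
Qed.

Lemma smooth_pd_mx F a : smooth_mx_on U F -> smooth_mx_on U (pd_mx a F).
Proof.
move=> CF i j; apply: (smooth_on_eq oU) (smooth_on_pd a (CF i j)) => v _.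
by rewrite mxE.
Qed.

End Mx.

Lemma smooth_scalar_mx n s : smooth_on U s ->
  smooth_mx_on U (fun u => (s u)%:M : 'M[R]_n).
Proof.
move=> Cs i j; have [->|ij] := eqVneq i j.
  by apply: (smooth_on_eq oU) Cs => v _; rewrite mxE eqxx.
apply: (smooth_on_eq oU) (smooth_on_cst oU 0) => v _.
by rewrite mxE (negPf ij).
Qed.

Section Block.
Variables (m1 m2 n1 n2 : nat).
Variables (A : 'rV[R]_d -> 'M[R]_(m1, n1)) (B : 'rV[R]_d -> 'M[R]_(m1, n2)).
Variables (C : 'rV[R]_d -> 'M[R]_(m2, n1)) (D : 'rV[R]_d -> 'M[R]_(m2, n2)).

Lemma smooth_block_mx : smooth_mx_on U A -> smooth_mx_on U B ->
  smooth_mx_on U C -> smooth_mx_on U D ->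
  smooth_mx_on U (fun u => block_mx (A u) (B u) (C u) (D u)).
Proof.
move=> CA CB CC CD i j; case: (split_ordP i) => i' ->; case: (split_ordP j) => j' ->.
- by apply: (smooth_on_eq oU) (CA i' j') => v _; rewrite block_mxEul.
- by apply: (smooth_on_eq oU) (CB i' j') => v _; rewrite block_mxEur.
- by apply: (smooth_on_eq oU) (CC i' j') => v _; rewrite block_mxEdl.
- by apply: (smooth_on_eq oU) (CD i' j') => v _; rewrite block_mxEdr.
Qed.

Lemma pd_block_mx a u : pd_mx a (fun u => block_mx (A u) (B u) (C u) (D u)) u
  = block_mx (pd_mx a A u) (pd_mx a B u) (pd_mx a C u) (pd_mx a D u).
Proof.
apply/matrixP => i j; case: (split_ordP i) => i' ->; case: (split_ordP j) => j' ->;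
  rewrite ?(block_mxEul, block_mxEur, block_mxEdl, block_mxEdr) !mxE;
  congr pd; apply/funext => v.
- by rewrite block_mxEul.
- by rewrite block_mxEur.
- by rewrite block_mxEdl.
- by rewrite block_mxEdr.
Qed.

End Block.

End MatrixCalculus.

(** * Ricci flatness of hyperkähler curvature tensors *)

Lemma quaternion_relations (R : comNzRingType) (m : nat) (I J K : 'M[R]_m) :
  I *m I = - 1%:M -> J *m J = - 1%:M -> K *m K = - 1%:M -> I *m J = K ->
  [/\ J *m I = - K, J *m K = I & K *m I = J].
Proof.
move=> II JJ KK IJ.
have JI : J *m I = - K.
  (* Writing each [K] as [I *m J] turns the left side into [(I *m I) *m J *m I *m (J *m J)], that is
     [J *m I]. *)
  have : I *m (K *m K) *m J = - (I *m J) by rewrite KK mulmxN mulmx1 mulNmx.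
  rewrite -[X in I *m (X *m _)]IJ -{1}IJ !mulmxA II !mulNmx mul1mx.
  by rewrite -!mulmxA JJ !mulmxN mulmx1 opprK IJ.
split=> //.
  by rewrite -IJ mulmxA JI -IJ mulNmx -mulmxA JJ mulmxN mulmx1 opprK.
by rewrite -IJ -mulmxA JI -IJ mulmxN mulmxA II mulNmx mul1mx opprK.
Qed.

Section RicciFlat.
Variables (R : numDomainType) (m : nat) (F : 'I_m -> 'I_m -> 'M[R]_m).
Hypothesis F_skew : forall a b, F a b = - F b a.
Hypothesis F_bianchi : forall a b c e, F a b c e + F b e c a + F e a c b = 0.

Let ricci : 'M[R]_m := \matrix_(b, e) \sum_c F c b c e.

(** Commutation moves [E] to the contracted index, and then the Bianchi identity turns the skew part
    of [ricci *m E] at [(b, e)] into the trace of [E *m F e b]. *)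
Lemma ricci_mul_endo (E : 'M[R]_m) : (forall a b, F a b *m E = E *m F a b) ->
  (forall a b, \tr (E *m F a b) = 0) -> (ricci *m E)^T = ricci *m E.
Proof.
move=> FE trE.
have step b e : (ricci *m E) b e = \sum_c \sum_x E c x * F c b x e.
  rewrite mxE; under eq_bigr do rewrite mxE mulr_suml.
  rewrite exchange_big /=; apply: eq_bigr => c _.
  by have /matrixP/(_ c e) := FE c b; rewrite !mxE.
apply/matrixP => b e; rewrite mxE !step; apply: (etrans (esym (addr0 _))).
rewrite -[X in _ + X](trE e b).
rewrite /mxtrace -big_split; apply: eq_bigr => c _ /=.
rewrite [(_ *m _) c c]mxE -big_split; apply: eq_bigr => x _ /=.
rewrite -mulrDr; congr (_ * _).
have /eqP := F_bianchi c e x b; rewrite addr_eq0 => /eqP ->.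
by rewrite F_skew !mxE opprK.
Qed.

(** Since [F] commutes with two anticommuting factors of each unit, its trace against [I], [J] or
    [K] equals its own opposite. So [ricci] and its products with [I], [J], [K] are symmetric, and
    moving units across gives Ric K = J^T I^T Ric = J^T Ric I = Ric J I = - Ric K. *)
Lemma hyperkahler_ricci_flat (I J K : 'M[R]_m) :
  I *m I = - 1%:M -> J *m J = - 1%:M -> K *m K = - 1%:M -> I *m J = K ->
  (forall a b, F a b *m I = I *m F a b) ->
  (forall a b, F a b *m J = J *m F a b) ->
  (forall a b, \tr (F a b) = 0) ->
  forall b e, \sum_c F c b c e = 0.
Proof.
move=> II JJ KK IJ FI FJ trF.
have [JI JK KI] := quaternion_relations II JJ KK IJ.
have FK a b : F a b *m K = K *m F a b by rewrite -IJ mulmxA FI -mulmxA FJ mulmxA.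
have anti (X Y Z : 'M[R]_m) : X *m Y = Z -> Y *m X = - Z ->
    (forall a b, F a b *m X = X *m F a b) -> forall a b, \tr (Z *m F a b) = 0.
  move=> XY YX FX a b.
  have : \tr (Z *m F a b) = - \tr (Z *m F a b).
    rewrite -{1}XY -mulmxA mxtrace_mulC -mulmxA FX mulmxA YX mulNmx.
    by rewrite raddfN.
  by move=> /eqP; rewrite -addr_eq0 -mulr2n mulrn_eq0 => /eqP.
have IK : I *m K = - J by rewrite -IJ mulmxA II mulNmx mul1mx.
have KJ : K *m J = - I by rewrite -IJ -mulmxA JJ mulmxN mulmx1.
have sI := ricci_mul_endo FI (anti J K I JK KJ FJ).
have sJ := ricci_mul_endo FJ (anti K I J KI IK FK).
have sK := ricci_mul_endo FK (anti I J K IJ JI FI).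
have s1 : ricci^T = ricci.
  have := @ricci_mul_endo 1%:M; rewrite mulmx1; apply=> a b.
    by rewrite mulmx1 mul1mx.
  by rewrite mul1mx.
rewrite !trmx_mul s1 in sI sJ sK.
have z : ricci *m K = 0.
  have : ricci *m K = - (ricci *m K).
    rewrite -[LHS]sK -{1}IJ trmx_mul -mulmxA sI (mulmxA J^T) sJ.
    by rewrite -mulmxA JI mulmxN.
  move=> /matrixP h; apply/matrixP => b e; have /eqP := h b e.
  by rewrite [X in _ == X]mxE -addr_eq0 -mulr2n mulrn_eq0 => /eqP ->; rewrite mxE.
have : ricci *m K *m K = 0 by rewrite z mul0mx.
rewrite -mulmxA KK mulmxN mulmx1 => /eqP; rewrite oppr_eq0 => /eqP/matrixP r0 b e.
by have := r0 b e; rewrite !mxE.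
Qed.

End RicciFlat.

(** * Parallel endomorphisms and curvature *)

Lemma add_mxE (R : nmodType) m n (A B : 'M[R]_(m, n)) i j :
  (A + B) i j = A i j + B i j.
Proof. by rewrite mxE. Qed.

Lemma oppmxE (R : zmodType) m n (A : 'M[R]_(m, n)) i j : (- A) i j = - A i j.
Proof. by rewrite mxE. Qed.

Lemma zeromxE (R : nmodType) m n i j : (0 : 'M[R]_(m, n)) i j = 0.
Proof. by rewrite mxE. Qed.

Ltac mx_ring := rewrite ?(mulmxDl, mulmxDr, mulNmx, mulmxN, opprD, opprK, mulmxA);
  apply/matrixP => ? ?; rewrite ?(add_mxE, oppmxE, zeromxE); ring.

(** Here [na], [nb] stand for connection matrices and [dab], [dba] for their derivatives. The
    hypothesis is the symmetry of the second derivatives of a parallel [E], with each first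
    derivative of [E] replaced by its commutator with the connection matrix. *)
Lemma curvature_endomorphism_alg (R : comNzRingType) r (E na nb dab dba : 'M[R]_r) :
  (E *m na - na *m E) *m nb + E *m dab - (dab *m E + nb *m (E *m na - na *m E))
  = (E *m nb - nb *m E) *m na + E *m dba - (dba *m E + na *m (E *m nb - nb *m E)) ->
  (dab - dba + na *m nb - nb *m na) *m E = E *m (dab - dba + na *m nb - nb *m na).
Proof.
move=> /eqP; rewrite -subr_eq0 => /eqP h; apply/esym/eqP; rewrite -subr_eq0; apply/eqP.
by rewrite -[RHS]h; mx_ring.
Qed.

(** The same integrability condition for a parallel bilinear form: its curvature endomorphisms are
    skew. *)
Lemma curvature_bilinear_alg (R : comNzRingType) r (H na nb dab dba : 'M[R]_r) :
  dab^T *m H + nb^T *m (na^T *m H + H *m na) + ((na^T *m H + H *m na) *m nb + H *m dab)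
  = dba^T *m H + na^T *m (nb^T *m H + H *m nb) + ((nb^T *m H + H *m nb) *m na + H *m dba) ->
  (dab - dba + na *m nb - nb *m na)^T *m H + H *m (dab - dba + na *m nb - nb *m na) = 0.
Proof.
move=> /eqP; rewrite -subr_eq0 => /eqP h; rewrite -[RHS]h.
by rewrite !(linearB, linearD) /= !trmx_mul; mx_ring.
Qed.

Lemma mxtrace_skew (R : realType) r (H F : 'M[R]_r) : H \in unitmx ->
  F^T *m H + H *m F = 0 -> \tr F = 0.
Proof.
move=> uH /eqP; rewrite addrC addr_eq0 => /eqP HF.
have : \tr F = - \tr F.
  rewrite -{1}[F](mulKmx uH) HF mulmxN raddfN /= mxtrace_mulC mulmxK//.
  by rewrite mxtrace_tr.
by move=> /eqP; rewrite -addr_eq0 -mulr2n mulrn_eq0 => /eqP.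
Qed.

Section Parallel.
Variables (R : realType) (d : nat) (M : smooth_manifold R d) (r : nat).
Variables (eta : connection_form M r) (c : chart M).
Hypothesis eta_smooth : forall a, smooth_mx_on (chart_image c) (fun u => eta c u a).
Implicit Types (E F H : local_field M 'M[R]_r) (a b : 'I_d) (u : 'rV[R]_d).

Let oU : open (chart_image c) := @coord_open _ _ M c.

Definition parallel_endo_on E := forall u a, chart_image c u ->
  nabla_endomorphism eta E c u a = 0.

Lemma pd_parallel_endo E a u : parallel_endo_on E -> chart_image c u ->
  pd_mx a (E c) u = E c u *m eta c u a - eta c u a *m E c u.
Proof.
move=> pE Uu; have /eqP := pE u a Uu; rewrite subr_eq0 => /eqP <-.
by rewrite addrK.
Qed.

Lemma curvature_endomorphism E : smooth_mx_on (chart_image c) (E c) ->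
  parallel_endo_on E -> forall u a b, chart_image c u ->
  curvature eta c u a b *m E c u = E c u *m curvature eta c u a b.
Proof.
move=> sE pE u a b Uu; apply: curvature_endomorphism_alg.
have key a' b' : pd_mx a' (pd_mx b' (E c)) u =
  (E c u *m eta c u a' - eta c u a' *m E c u) *m eta c u b'
  + E c u *m pd_mx a' (fun v => eta c v b') u
  - (pd_mx a' (fun v => eta c v b') u *m E c u
     + eta c u b' *m (E c u *m eta c u a' - eta c u a' *m E c u)).
  transitivity (pd_mx a' (fun v => E c v *m eta c v b' - eta c v b' *m E c v) u).
    by apply: (pd_mx_eq_on oU) => // v Uv; exact: pd_parallel_endo.
  have s1 : smooth_mx_on (chart_image c) (fun v => E c v *m eta c v b').
    exact: smooth_mxM.
  have s2 : smooth_mx_on (chart_image c) (fun v => eta c v b' *m E c v).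
    exact: smooth_mxM.
  rewrite (pd_mxD oU a' s1 (smooth_mxN oU s2) Uu) (pd_mxN oU a' s2 Uu).
  rewrite (pd_mxM oU a' sE (eta_smooth b') Uu) (pd_mxM oU a' (eta_smooth b') sE Uu).
  by rewrite (pd_parallel_endo a' pE Uu).
by rewrite -!key; exact: (pd_mx_comm oU).
Qed.

Lemma curvature_bilinear H : smooth_mx_on (chart_image c) (H c) ->
  (forall u a, chart_image c u -> nabla_bilinear eta H c u a = 0) ->
  forall u a b, chart_image c u ->
  (curvature eta c u a b)^T *m H c u + H c u *m curvature eta c u a b = 0.
Proof.
move=> sH pH u a b Uu; apply: curvature_bilinear_alg.
have pdH v e : chart_image c v ->
    pd_mx e (H c) v = (eta c v e)^T *m H c v + H c v *m eta c v e.
  move=> Uv; have /eqP := pH v e Uv; rewrite subr_eq0 => /eqP <-.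
  by rewrite addrC subrK.
have key a' b' : pd_mx a' (pd_mx b' (H c)) u =
  (pd_mx a' (fun v => eta c v b') u)^T *m H c u
  + (eta c u b')^T *m ((eta c u a')^T *m H c u + H c u *m eta c u a')
  + (((eta c u a')^T *m H c u + H c u *m eta c u a') *m eta c u b'
     + H c u *m pd_mx a' (fun v => eta c v b') u).
  transitivity (pd_mx a' (fun v => (eta c v b')^T *m H c v + H c v *m eta c v b') u).
    by apply: (pd_mx_eq_on oU) => // v Uv; exact: pdH.
  have st := smooth_mx_tr oU (eta_smooth b').
  have s1 : smooth_mx_on (chart_image c) (fun v => (eta c v b')^T *m H c v).
    exact: smooth_mxM.
  have s2 : smooth_mx_on (chart_image c) (fun v => H c v *m eta c v b').
    exact: smooth_mxM.
  rewrite (pd_mxD oU a' s1 s2 Uu) (pd_mxM oU a' st sH Uu).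
  by rewrite (pd_mxM oU a' sH (eta_smooth b') Uu) pd_mx_tr pdH.
by rewrite -!key; exact: (pd_mx_comm oU).
Qed.

Lemma parallel_endoM E F : smooth_mx_on (chart_image c) (E c) ->
  smooth_mx_on (chart_image c) (F c) ->
  parallel_endo_on E -> parallel_endo_on F ->
  parallel_endo_on (fun i u => E i u *m F i u).
Proof.
move=> sE sF pE pF u a Uu; rewrite /nabla_endomorphism (pd_mxM oU)//.
rewrite (pd_parallel_endo a pE Uu) (pd_parallel_endo a pF Uu).
by rewrite /=; mx_ring.
Qed.

Lemma parallel_endoD E F : smooth_mx_on (chart_image c) (E c) ->
  smooth_mx_on (chart_image c) (F c) ->
  parallel_endo_on E -> parallel_endo_on F ->
  parallel_endo_on (fun i u => E i u + F i u).
Proof.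
move=> sE sF pE pF u a Uu; rewrite /nabla_endomorphism (pd_mxD oU)//.
rewrite (pd_parallel_endo a pE Uu) (pd_parallel_endo a pF Uu).
by rewrite /=; mx_ring.
Qed.

Lemma parallel_endoN E : smooth_mx_on (chart_image c) (E c) ->
  parallel_endo_on E -> parallel_endo_on (fun i u => - E i u).
Proof.
move=> sE pE u a Uu; rewrite /nabla_endomorphism (pd_mxN oU)//.
by rewrite (pd_parallel_endo a pE Uu) /=; mx_ring.
Qed.

Lemma parallel_endo1 : parallel_endo_on (fun _ _ => 1%:M).
Proof.
move=> u a Uu; rewrite /nabla_endomorphism (pd_mx_cst _ a u).
by rewrite mulmx1 mul1mx add0r subrr.
Qed.

End Parallel.

(** * The cone connection *)

Lemma trmx_opp (V : zmodType) m n (A : 'M[V]_(m, n)) : (- A)^T = - A^T.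
Proof. by apply/matrixP => i j; rewrite !mxE. Qed.

Lemma delta_mul_row (V : nzSemiRingType) m n p (A : 'M[V]_(m, n)) (a i : 'I_p) b j :
  (delta_mx a (0 : 'I_1) *m row b A) i j = (i == a)%:R * A b j.
Proof. by rewrite mxE big_ord1 !mxE eqxx andbT. Qed.

Section ConeDefs.
Variables (R : realType) (d : nat) (M : smooth_manifold R d).
Implicit Types (g : local_field M 'M[R]_d) (nabla : connection_form M d).
Implicit Types (k : local_field M 'cV[R]_d).

(* The Levi-Civita connection of the metric cone over (M, g), on the fibre
   R + TM of its tangent bundle. *)
Definition cone_form g nabla : connection_form M (1 + d) := fun i u a =>
  block_mx 0 (- row a (g i u)) (delta_mx a 0) (nabla i u a).

Definition cone_metric g : local_field M 'M[R]_(1 + d) := fun i u =>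
  block_mx 1%:M 0 0 (g i u).

(** Columns carry the direction of differentiation, so that [nabla_mx nabla k c u *m Y c u] is the
    derivative of [k] along [Y]. *)
Definition nabla_mx nabla k : local_field M 'M[R]_d := fun i u =>
  \matrix_(c, b) nabla_vector nabla k i u b c.

Definition cone_endo g nabla k : local_field M 'M[R]_(1 + d) := fun i u =>
  block_mx 0 (- (g i u *m k i u)^T) (k i u) (nabla_mx nabla k i u).

Definition apex : 'cV[R]_(1 + d) := col_mx 1%:M 0.

Lemma endo_apex (E : 'M[R]_(1 + d)) : E *m apex = 0 ->
  (forall a : 'I_d, E *m col_mx (0 : 'cV_1) (delta_mx a 0) = 0) -> E = 0.
Proof.
move=> E0 Ea; rewrite -[E]submxK in E0 Ea *.
move: E0; rewrite mul_block_col !mulmx1 !mulmx0 !addr0 => /eqP.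
rewrite col_mx_eq0 => /andP[/eqP -> /eqP ->].
have Z m (A : 'M[R]_(m, d)) : (forall a : 'I_d, A *m delta_mx a (0 : 'I_1) = 0) -> A = 0.
  move=> A0; apply/matrixP => i j; have /matrixP/(_ i 0) := A0 j.
  by rewrite -colE !mxE.
suff [-> ->] : ursubmx E = 0 /\ drsubmx E = 0 by rewrite block_mx0.
split; apply: Z => a; have /eqP := Ea a; rewrite mul_block_col !mulmx0 !add0r;
  by rewrite col_mx_eq0 => /andP[/eqP ? /eqP ?].
Qed.

End ConeDefs.

Section Cone.
Variables (R : realType) (d : nat) (M : smooth_manifold R d).
Variables (g : local_field M 'M[R]_d) (nabla : connection_form M d) (c : chart M).
Hypothesis lc : is_levi_civita g nabla.
Hypothesis gm : is_metric g.
Implicit Types (a b e : 'I_d) (u : 'rV[R]_d) (k : local_field M 'cV[R]_d).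

Let U := chart_image c.
Let oU : open U := @coord_open _ _ M c.

Lemma smooth_metric : smooth_mx_on U (g c).
Proof. exact: gm.1.1. Qed.

Lemma smooth_lc a : smooth_mx_on U (fun u => nabla c u a).
Proof. by have [[sn _] _ _] := lc; exact: sn. Qed.

Lemma smooth_cone_form a : smooth_mx_on U (fun u => cone_form g nabla c u a).
Proof.
apply: (smooth_block_mx oU); try exact: smooth_mx_cst; last exact: smooth_lc.
apply: (smooth_mxN oU) => i b.
apply: (smooth_on_eq oU) (smooth_metric a b) => v _.
by rewrite mxE.
Qed.

Lemma smooth_cone_metric : smooth_mx_on U (cone_metric g c).
Proof.
by apply: (smooth_block_mx oU); try exact: smooth_mx_cst; exact: smooth_metric.
Qed.

Lemma metric_tr u : U u -> (g c u)^T = g c u.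
Proof. by move=> Uu; have [] := gm.2 c u Uu. Qed.

Lemma metric_unit u : U u -> g c u \in unitmx.
Proof. by move=> Uu; have [] := gm.2 c u Uu. Qed.

Lemma pd_metric a u : U u ->
  pd_mx a (g c) u = (nabla c u a)^T *m g c u + g c u *m nabla c u a.
Proof.
move=> Uu; have [_ _ /(_ c u a Uu)/eqP] := lc; rewrite subr_eq0 => /eqP <-.
by rewrite addrC subrK.
Qed.

Lemma torsion_col a b u : U u ->
  nabla c u a *m delta_mx b (0 : 'I_1) = nabla c u b *m delta_mx a 0.
Proof.
move=> Uu; have [_ T _] := lc; apply/matrixP => i j.
by rewrite -!colE !mxE; exact: T.
Qed.

Lemma cone_metric_parallel u a : U u ->
  nabla_bilinear (cone_form g nabla) (cone_metric g) c u a = 0.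
Proof.
move=> Uu; rewrite /nabla_bilinear pd_block_mx !pd_mx_cst pd_metric//.
rewrite tr_block_mx !mulmx_block !trmx0 !(mulmx0, mul0mx, mulmx1, mul1mx).
rewrite !(addr0, add0r) !opp_block_mx !add_block_mx.
rewrite -[RHS]block_mx0; congr block_mx.
- by rewrite !subr0.
- by rewrite sub0r opprK trmx_delta rowE addNr.
- by rewrite sub0r trmx_opp opprK rowE trmx_mul trmx_delta metric_tr// subrr.
- by mx_ring.
Qed.

(** The Riemann tensor minus that of constant curvature 1; it vanishes on the unit sphere, whose
    cone is flat. *)
Definition cone_curvature u a b : 'M[R]_d :=
  curvature nabla c u a b - delta_mx a (0 : 'I_1) *m row b (g c u)
  + delta_mx b (0 : 'I_1) *m row a (g c u).

Lemma pd_row_metric a b u : U u -> pd_mx a (fun v => row b (g c v)) u =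
  (nabla c u a *m delta_mx b (0 : 'I_1))^T *m g c u + row b (g c u) *m nabla c u a.
Proof.
move=> Uu; transitivity (row b (pd_mx a (g c) u)).
  apply/matrixP => i j; rewrite !mxE; congr pd.
  by apply/funext => v; rewrite mxE.
by rewrite pd_metric// !rowE mulmxDr !mulmxA trmx_mul trmx_delta.
Qed.

(** The scalar block vanishes by symmetry of [g], the lower left one by absence of torsion, the
    upper right one by absence of torsion together with metric compatibility. *)
Lemma curvature_cone_form u a b : U u -> curvature (cone_form g nabla) c u a b =
  block_mx 0 0 0 (cone_curvature u a b).
Proof.
move=> Uu; rewrite /curvature !pd_block_mx !pd_mx_cst.
have srow e : smooth_mx_on U (fun v => row e (g c v)).
  by move=> i j; apply: (smooth_on_eq oU) (smooth_metric e j) => v _; rewrite mxE.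
rewrite !(pd_mxN oU _ (srow _) Uu) !pd_row_metric//.
rewrite !mulmx_block !(mulmx0, mul0mx, addr0, add0r) !opp_block_mx !add_block_mx.
rewrite (torsion_col b a Uu); congr block_mx.
- rewrite !(subr0, add0r) !mulNmx -!colE opprK addrC; apply/matrixP => i j.
  rewrite !mxE; have /matrixP/(_ a b) := metric_tr Uu; rewrite mxE => ->.
  by rewrite subrr.
- by mx_ring.
- by rewrite !(subr0, add0r) subrr.
- by rewrite /cone_curvature /curvature; mx_ring.
Qed.

(** All terms cancel in pairs in the cyclic sum: [t1] and [t2] are symmetric in their last two
    indices because [nabla] has no torsion, and [g] is symmetric. *)
Lemma cone_bianchi u : U u -> forall a b e f,
  cone_curvature u a b f e + cone_curvature u b e f a + cone_curvature u e a f b = 0.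
Proof.
move=> Uu a b e f.
have gs x y : g c u x y = g c u y x.
  by have /matrixP/(_ x y) := metric_tr Uu; rewrite mxE => ->.
have T v x y z : U v -> nabla c v x z y = nabla c v y z x.
  by move=> Uv; have [_ T _] := lc; exact: T.
pose t1 x y z := pd x (fun v => nabla c v y f z) u.
have t1s x y z : t1 x y z = t1 x z y by apply: (pd_eq_on oU) => // v Uv; exact: T.
pose t2 x y z := (nabla c u x *m nabla c u y) f z.
have t2s x y z : t2 x y z = t2 x z y.
  by rewrite /t2 !mxE; apply: eq_bigr => w _; rewrite (T u y z).
have E x y z : cone_curvature u x y f z = t1 x y z - t1 y x z + t2 x y z - t2 y x z
   - (f == x)%:R * g c u y z + (f == y)%:R * g c u x z.
  rewrite /cone_curvature /curvature !(add_mxE, oppmxE).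
  rewrite [pd_mx x _ u f z]mxE [pd_mx y _ u f z]mxE.
  by rewrite !delta_mul_row.
rewrite !E (t1s a e b) (t1s b e a) (t1s e b a) (t2s a e b) (t2s b e a) (t2s e b a).
rewrite (gs e b) (gs a b) (gs a e).
move: (t1 _ _ _) (t1 _ _ _) (t1 _ _ _) (t2 _ _ _) (t2 _ _ _) (t2 _ _ _) => x1 x2 x3 x4 x5 x6.
move: (g c u _ _) (g c u _ _) (g c u _ _) => y1 y2 y3.
by move: (_ == a)%:R (_ == b)%:R (_ == e)%:R => z1 z2 z3; ring.
Qed.

(* A parallel endomorphism is determined by its value at the apex, because the
   derivative of the apex section in the direction a is the a-th tangent vector. *)
Lemma parallel_endo_apex (E : local_field M 'M[R]_(1 + d)) :
  smooth_mx_on U (E c) -> parallel_endo_on (cone_form g nabla) c E ->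
  (forall u, U u -> E c u *m apex R d = 0) -> forall u, U u -> E c u = 0.
Proof.
move=> sE pE E0 u Uu; apply: endo_apex => [|a]; first exact: E0.
have := pd_mx_eq_on oU a Uu E0; rewrite pd_mx_cst (pd_mxM oU)//; last first.
  exact: smooth_mx_cst.
rewrite pd_mx_cst mulmx0 addr0 (pd_parallel_endo a pE Uu) mulmxBl -!mulmxA E0//.
have -> : cone_form g nabla c u a *m apex R d = col_mx 0 (delta_mx a 0).
  by rewrite mul_block_col !mul0mx !mulmx0 !mulmx1 !addr0.
by rewrite mulmx0 subr0.
Qed.

End Cone.

(** * Sasaki structures as parallel endomorphisms of the cone *)

Section Sasaki.
Variables (R : realType) (d : nat) (M : smooth_manifold R d).
Variables (g : local_field M 'M[R]_d) (nabla : connection_form M d) (c : chart M).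
Hypothesis lc : is_levi_civita g nabla.
Hypothesis gm : is_metric g.
Implicit Types (a b e : 'I_d) (u : 'rV[R]_d) (k X Y Z : local_field M 'cV[R]_d).

Let U := chart_image c.
Let oU : open U := @coord_open _ _ M c.

Lemma nabla_mx_delta k u a : nabla_mx nabla k c u *m delta_mx a (0 : 'I_1) =
  pd_mx a (k c) u + nabla c u a *m k c u.
Proof. by apply/matrixP => i j; rewrite -colE !mxE (ord1 j). Qed.

Lemma smooth_nabla_mx k : smooth_mx_on U (k c) -> smooth_mx_on U (nabla_mx nabla k c).
Proof.
move=> sk i b.
have s : smooth_mx_on U (fun v => pd_mx b (k c) v + nabla c v b *m k c v).
  apply: (smooth_mxD oU); first exact: smooth_pd_mx.
  by apply: (smooth_mxM oU) => //; exact: (smooth_lc c lc).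
apply: (smooth_on_eq oU) (s i 0) => v _.
by rewrite -nabla_mx_delta -colE mxE.
Qed.

Lemma smooth_cone_endo k : smooth_mx_on U (k c) -> smooth_mx_on U (cone_endo g nabla k c).
Proof.
move=> sk; apply: (smooth_block_mx oU) => //; last exact: smooth_nabla_mx.
  exact: smooth_mx_cst.
apply: (smooth_mxN oU); apply: (smooth_mx_tr oU); apply: (smooth_mxM oU) => //.
exact: smooth_metric.
Qed.

Lemma killing_skew k u : is_killing g k -> U u ->
  (nabla_mx nabla k c u)^T *m g c u + g c u *m nabla_mx nabla k c u = 0.
Proof.
move=> [_ kil] Uu; apply/matrixP => a b; rewrite [RHS]mxE -(kil c u a b Uu).
have T x y z : nabla c u x z y = nabla c u y z x.
  by have [_ T _] := lc; exact: T.
rewrite !mxE /lie_derivative_bilinear -big_split /=.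
under eq_bigr do rewrite !mxE /nabla_vector.
have -> : \sum_(i < d) (k c u i 0 * pd i (fun v => g c v a b) u
     + g c u i b * pd a (fun v => k c v i 0) u
     + g c u a i * pd b (fun v => k c v i 0) u) =
   \sum_(i < d) (g c u i b * pd a (fun v => k c v i 0) u
     + g c u a i * pd b (fun v => k c v i 0) u)
   + \sum_(i < d) k c u i 0 * pd i (fun v => g c v a b) u.
  by rewrite -big_split; apply: eq_bigr => i _ /=; rewrite addrC addrA addrAC addrC addrA.
(* Metric compatibility expands the derivative of [g] along [k], and symmetry of the Christoffel
   symbols turns the result into exactly the terms that complete the partial derivatives of [k] to
   covariant ones. *)
have -> : \sum_(i < d) k c u i 0 * pd i (fun v => g c v a b) u =
   \sum_(i < d) ((\sum_(e < d) nabla c u a i e * k c u e 0) * g c u i b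
     + g c u a i * (\sum_(e < d) nabla c u b i e * k c u e 0)).
  under eq_bigr => i _.
    have := pd_metric lc i Uu => /matrixP/(_ a b); rewrite !mxE => ->.
    rewrite mulrDr !mulr_sumr -big_split /=.
    over.
  rewrite exchange_big /=; apply: eq_bigr => i _.
  rewrite big_split mulr_suml mulr_sumr /=; congr (_ + _); apply: eq_bigr => e _.
    by rewrite mxE T; ring.
  by rewrite T; ring.
rewrite -big_split; apply: eq_bigr => i _ /=.
by ring.
Qed.

(** Block by block: the left column vanishes identically, the upper right block is the Killing
    equation, and the lower right block is the Sasaki equation. *)
Lemma cone_endo_parallel k : is_sasaki g nabla k ->
  parallel_endo_on (cone_form g nabla) c (cone_endo g nabla k).
Proof.
move=> sk u a Uu; have [[sk1 _] _] := sasaki_killing sk.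
have {}sk1 := sk1 c; have sg := smooth_metric c gm.
have sgk : smooth_mx_on U (fun v => (g c v *m k c v)^T).
  by apply: (smooth_mx_tr oU); exact: smooth_mxM.
rewrite /nabla_endomorphism pd_block_mx pd_mx_cst (pd_mxN oU a sgk Uu).
rewrite pd_mx_tr (pd_mxM oU a sg sk1 Uu) (pd_metric lc a Uu).
rewrite !mulmx_block !(mulmx0, mul0mx, addr0, add0r) opp_block_mx !add_block_mx.
have kil := killing_skew (sasaki_killing sk) Uu.
have gs := metric_tr gm Uu.
have Dk := nabla_mx_delta k u a.
rewrite -[RHS]block_mx0; congr block_mx.
- rewrite !mulNmx opprK -colE -row_mul; apply/matrixP => i j.
  by rewrite !mxE add0r (ord1 i) (ord1 j) addNr.
- have Eg : (nabla_mx nabla k c u)^T *m g c u = - (g c u *m nabla_mx nabla k c u).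
    by apply/eqP; rewrite -addr_eq0 kil.
  rewrite !mulNmx opprK -!row_mul.
  have -> : row a (g c u *m nabla_mx nabla k c u) =
      - (g c u *m (nabla_mx nabla k c u *m delta_mx a (0 : 'I_1)))^T.
    by rewrite rowE -[g c u *m nabla_mx _ _ _ _]opprK -Eg mulmxN !trmx_mul trmx_delta gs mulmxA.
  rewrite Dk !(mulmxDr, mulmxDl) !linearD /= !trmx_mul gs trmxK; mx_ring.
- by rewrite Dk; mx_ring.
- apply/matrixP => f b; have := sasaki_eq sk a b f Uu.
  rewrite /nabla2_vector /flat => /eqP; rewrite -subr_eq0 => /eqP E; rewrite [RHS]mxE -[RHS]E.
  rewrite !(add_mxE, oppmxE).
  have -> : (delta_mx a 0 *m - (g c u *m k c u)^T) f b =
      - ((f == a)%:R * \sum_(e < d) g c u e b * k c u e 0).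
    rewrite mulmxN oppmxE mxE big_ord1 !mxE eqxx andbT; congr (- (_ * _)).
    by apply: eq_bigr => e _; rewrite -{1}gs mxE.
  have -> : (k c u *m - row a (g c u)) f b = - (g c u a b * k c u f 0).
    by rewrite mulmxN oppmxE mxE big_ord1 !mxE mulrC.
  have -> : (nabla c u a *m nabla_mx nabla k c u) f b =
      \sum_(e < d) nabla c u a f e * nabla_vector nabla k c u b e.
    by rewrite mxE; apply: eq_bigr => e _; rewrite mxE.
  have -> : (nabla_mx nabla k c u *m nabla c u a) f b =
      \sum_(e < d) nabla c u a e b * nabla_vector nabla k c u e f.
    by rewrite mxE; apply: eq_bigr => e _; rewrite mxE mulrC.
  have -> : pd_mx a (nabla_mx nabla k c) u f b =
      pd a (fun v => nabla_vector nabla k c v b f) u.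
    by rewrite mxE; congr pd; apply/funext => v; rewrite mxE.
  move: (pd _ _ _) (\sum_(e < d) _) (\sum_(e < d) _) (\sum_(e < d) _) (_ * _) (_%:R).
  by move=> x1 x2 x3 x4 x5 x6; ring.
Qed.

End Sasaki.

(** * Quaternion relations on the cone *)

Section Quaternionic.
Variables (R : realType) (d : nat) (M : smooth_manifold R d).
Variables (g : local_field M 'M[R]_d) (nabla : connection_form M d) (c : chart M).
Hypothesis lc : is_levi_civita g nabla.
Hypothesis gm : is_metric g.
Implicit Types (a b e : 'I_d) (u : 'rV[R]_d) (k X Y Z : local_field M 'cV[R]_d).

Let U := chart_image c.
Let oU : open U := @coord_open _ _ M c.

Lemma smooth_killing X : is_killing g X -> smooth_mx_on U (X c).
Proof. by move=> [[sX _] _]; exact: sX. Qed.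

(** Differentiating the constant [inner g X Y] and moving the derivatives across by Killing skewness
    shows that the derivative of X along Y plus that of Y along X is orthogonal to every vector. The
    case [X = Y] says that a Killing field of constant length has geodesic orbits. *)
Lemma nabla_mx_anticomm X Y (r : R) : is_killing g X -> is_killing g Y ->
  (forall u, U u -> inner g X Y c u = r) -> forall u, U u ->
  nabla_mx nabla X c u *m Y c u = - (nabla_mx nabla Y c u *m X c u).
Proof.
move=> kX kY XYr u Uu; have sX := smooth_killing kX; have sY := smooth_killing kY.
have sg := smooth_metric c gm; have gt := metric_tr gm Uu.
have sXt := smooth_mx_tr oU sX.
have XY v : U v -> (X c v)^T *m g c v *m Y c v = r%:M.
  by move=> Uv; apply/matrixP => i j; rewrite !ord1 [RHS]mxE -(XYr v Uv).
pose DX := nabla_mx nabla X c u; pose DY := nabla_mx nabla Y c u.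
have skX : DX^T *m g c u = - (g c u *m DX).
  by apply/eqP; rewrite -addr_eq0; apply/eqP; exact: killing_skew.
have skY : DY^T *m g c u = - (g c u *m DY).
  by apply/eqP; rewrite -addr_eq0; apply/eqP; exact: killing_skew.
have key a : (delta_mx a (0 : 'I_1))^T *m (DX^T *m g c u *m Y c u + DY^T *m g c u *m X c u) = 0.
  have := pd_mx_eq_on oU a Uu XY; rewrite pd_mx_cst.
  have sXg := smooth_mxM oU sXt sg.
  rewrite (pd_mxM oU a sXg sY Uu) (pd_mxM oU a sXt sg Uu) pd_mx_tr.
  rewrite (pd_metric lc a Uu) => h.
  have pX : pd_mx a (X c) u = DX *m delta_mx a 0 - nabla c u a *m X c u.
    by rewrite nabla_mx_delta addrK.
  have pY : pd_mx a (Y c) u = DY *m delta_mx a 0 - nabla c u a *m Y c u.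
    by rewrite nabla_mx_delta addrK.
  have e : (delta_mx a (0 : 'I_1))^T *m (DY^T *m g c u *m X c u) =
      (X c u)^T *m g c u *m (DY *m delta_mx a 0).
    have tr11 (A : 'M[R]_1) : A^T = A by apply/matrixP => i j; rewrite !ord1 mxE.
    by rewrite -[LHS]tr11 !trmx_mul !trmxK gt !mulmxA.
  rewrite mulmxDr e -[RHS]h pX pY !(linearB, linearD) /= !trmx_mul; mx_ring.
have gu := metric_unit gm Uu.
have : DX^T *m g c u *m Y c u + DY^T *m g c u *m X c u = 0.
  apply/matrixP => i j; have /matrixP/(_ 0 j) := key i.
  by rewrite trmx_delta -rowE !mxE.
rewrite skX skY !mulNmx -opprD => /eqP; rewrite oppr_eq0 -!mulmxA -mulmxDr => /eqP h.
by apply/eqP; rewrite -addr_eq0 -[_ + _](mulKmx gu) h mulmx0.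
Qed.

Lemma lie_bracket_nabla X Y u : U u -> lie_bracket X Y c u =
  nabla_mx nabla Y c u *m X c u - nabla_mx nabla X c u *m Y c u.
Proof.
move=> Uu; have T x y z : nabla c u x z y = nabla c u y z x.
  by have [_ T _] := lc; exact: T.
apply/matrixP => f j; rewrite (ord1 j) !mxE.
under [in RHS]eq_bigr do rewrite mxE /nabla_vector mulrDl mulr_suml.
rewrite [X in _ = _ - X](eq_bigr (fun a => pd a (fun v => X c v f 0) u * Y c u a 0
   + \sum_(e < d) nabla c u a f e * X c u e 0 * Y c u a 0)); last first.
  by move=> a _; rewrite mxE /nabla_vector mulrDl mulr_suml.
rewrite !big_split /= [X in _ = _ - (_ + X)]exchange_big /=.
rewrite [X in _ = _ - (_ + X)](eq_bigr
  (fun a => \sum_(e < d) nabla c u a f e * Y c u e 0 * X c u a 0)); last first.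
  by move=> a _; apply: eq_bigr => e _; rewrite T mulrAC.
rewrite opprD addrACA subrr addr0 -sumrN; congr (_ + _).
  by apply: eq_bigr => a _; rewrite mulrC.
by apply: eq_bigr => a _; rewrite mulrC.
Qed.

Lemma cone_endo_apex k u : cone_endo g nabla k c u *m apex R d = col_mx 0 (k c u).
Proof. by rewrite mul_block_col !mulmx1 !mulmx0 !addr0. Qed.

Lemma cone_endo_tangent X Y u : U u -> cone_endo g nabla X c u *m col_mx 0 (Y c u) =
  col_mx (- (inner g X Y c u)%:M) (nabla_mx nabla X c u *m Y c u).
Proof.
move=> Uu; rewrite mul_block_col !mulmx0 !add0r; congr col_mx.
rewrite mulNmx trmx_mul metric_tr//; congr (- _).
by apply/matrixP => i j; rewrite !ord1 [RHS]mxE.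
Qed.

Lemma cone_endo_sq k u : is_sasaki g nabla k -> U u ->
  cone_endo g nabla k c u *m cone_endo g nabla k c u = - 1%:M.
Proof.
move=> sk Uu; have kk := sasaki_killing sk.
have sE := smooth_cone_endo lc gm (smooth_killing kk).
have pE := cone_endo_parallel (c := c) lc gm sk.
have sEE := smooth_mxM oU sE sE.
have s1 : smooth_mx_on U (fun=> 1%:M : 'M[R]_(1 + d)) by exact: smooth_mx_cst.
have sF := smooth_cone_form c lc gm.
have pEE := parallel_endoM sE sE pE pE.
have pEE1 := parallel_endoD sEE s1 pEE (parallel_endo1 (c := c) (cone_form g nabla)).
apply/eqP; rewrite -addr_eq0; apply/eqP; move: u Uu.
apply: (parallel_endo_apex _ pEE1); first exact: smooth_mxD.
(* Applied twice to the apex, the endomorphism gives minus the squared length of [k] and the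
   derivative of [k] along itself, which is 0. *)
move=> u Uu /=; rewrite mulmxDl -mulmxA cone_endo_apex cone_endo_tangent// mul1mx.
have := nabla_mx_anticomm kk kk (sasaki_unit sk (i := c)) Uu.
move=> /eqP; rewrite -addr_eq0 => /eqP kz.
have -> : nabla_mx nabla k c u *m k c u = 0.
  apply/matrixP => i j; have /matrixP/(_ i j)/eqP := kz.
  by rewrite add_mxE -mulr2n !mxE mulrn_eq0 => /eqP.
by rewrite (sasaki_unit sk)// add_col_mx addNr addr0 col_mx0.
Qed.

Lemma cone_endo_skew k u : is_killing g k -> U u ->
  (cone_endo g nabla k c u)^T *m cone_metric g c u =
  - (cone_metric g c u *m cone_endo g nabla k c u).
Proof.
move=> kk Uu; have /eqP := killing_skew (c := c) lc kk Uu.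
rewrite addr_eq0 => /eqP sk; rewrite tr_block_mx !mulmx_block.
rewrite !(mulmx0, mul0mx, mulmx1, mul1mx, addr0, add0r, trmx0) sk opp_block_mx.
by rewrite trmx_opp trmxK oppr0 opprK trmx_mul metric_tr.
Qed.

(** A skew endomorphism of square -1 is an isometry. *)
Lemma cone_endo_hermitian k u : is_sasaki g nabla k -> U u ->
  (cone_endo g nabla k c u)^T *m cone_metric g c u *m cone_endo g nabla k c u =
  cone_metric g c u.
Proof.
move=> sk Uu; rewrite cone_endo_skew//; last exact: (sasaki_killing sk).
by rewrite mulNmx -mulmxA cone_endo_sq// mulmxN mulmx1 opprK.
Qed.

(** At the apex the product has radial part [- inner g X Y], which is 0, and tangential part the
    derivative of X along Y. By [nabla_mx_anticomm] the bracket is -2 times that derivative, so the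
    factor -2 in the structure equations makes it [Z]. *)
Lemma cone_endo_mul X Y Z u : is_sasaki g nabla X -> is_sasaki g nabla Y ->
  is_sasaki g nabla Z -> (forall u, U u -> inner g X Y c u = 0) ->
  (forall u, U u -> lie_bracket X Y c u = - 2 *: Z c u) -> U u ->
  cone_endo g nabla X c u *m cone_endo g nabla Y c u = cone_endo g nabla Z c u.
Proof.
move=> SX SY SZ XY0 br Uu.
have kX := sasaki_killing SX; have kY := sasaki_killing SY; have kZ := sasaki_killing SZ.
have sX := smooth_cone_endo lc gm (smooth_killing kX).
have sY := smooth_cone_endo lc gm (smooth_killing kY).
have sZ := smooth_cone_endo lc gm (smooth_killing kZ).
have pX := cone_endo_parallel (c := c) lc gm SX.
have pY := cone_endo_parallel (c := c) lc gm SY.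
have pZ := cone_endo_parallel (c := c) lc gm SZ.
have sXY := smooth_mxM oU sX sY.
have pXY := parallel_endoM sX sY pX pY.
have pXYZ := parallel_endoD sXY (smooth_mxN oU sZ) pXY (parallel_endoN sZ pZ).
apply/eqP; rewrite -subr_eq0; apply/eqP; move: u Uu.
apply: (parallel_endo_apex _ pXYZ); first by apply: (smooth_mxD oU) => //; exact: smooth_mxN.
move=> u Uu /=; rewrite mulmxDl -mulmxA mulNmx !cone_endo_apex cone_endo_tangent// XY0//.
have := br u Uu; rewrite lie_bracket_nabla//.
rewrite (nabla_mx_anticomm kX kY XY0 Uu) opprK => /eqP; rewrite -subr_eq0 => /eqP h.
rewrite opp_col_mx add_col_mx subr0 raddf0 oppr0.
suff -> : - (nabla_mx nabla Y c u *m X c u) - Z c u = 0 by rewrite col_mx0.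
apply/matrixP => i j; have /matrixP/(_ i j) := h.
have zE : (- 2 *: Z c u) i j = - 2 * Z c u i j by rewrite mxE.
rewrite !(add_mxE, oppmxE, zeromxE) zE; move: (_ i j) (Z c u i j) => x y h'.
by lra.
Qed.

End Quaternionic.

(** * The Einstein equation *)

Section Einstein.
Variables (R : realType) (d : nat) (M : smooth_manifold R d).
Variables (g : local_field M 'M[R]_d) (nabla : connection_form M d) (c : chart M).
Variables (X Y Z : local_field M 'cV[R]_d).
Hypothesis lc : is_levi_civita g nabla.
Hypothesis s3 : is_3sasaki g nabla X Y Z.
Implicit Types (a b e : 'I_d) (u : 'rV[R]_d).

Let U := chart_image c.
Let oU : open U := @coord_open _ _ M c.
Let gm : is_metric g := sasaki_metric (sasaki3_1 s3).

Lemma cone_metric_unit u : U u -> cone_metric g c u \in unitmx.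
Proof.
move=> Uu; rewrite unitmxE det_lblock det1 mul1r -unitmxE.
exact: metric_unit.
Qed.

(* The curvature of the cone as a 2-form on the whole cone: it vanishes when one
   argument is radial. *)
Definition cone_riemann u (A B : 'I_(1 + d)) : 'M[R]_(1 + d) :=
  match fintype.split A, fintype.split B with
  | inr a, inr b => curvature (cone_form g nabla) c u a b
  | _, _ => 0
  end.

Lemma cone_riemannE u a b : U u -> cone_riemann u (rshift 1 a) (rshift 1 b) =
  block_mx 0 0 0 (cone_curvature g nabla c u a b).
Proof.
move=> Uu; rewrite /cone_riemann (unsplitK (inr a)) (unsplitK (inr b)).
exact: curvature_cone_form.
Qed.

Lemma cone_riemannl u B (a : 'I_1) : cone_riemann u (lshift d a) B = 0.
Proof. by rewrite /cone_riemann (unsplitK (inl a)). Qed.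

Lemma cone_riemannr u A (a : 'I_1) : cone_riemann u A (lshift d a) = 0.
Proof. by rewrite /cone_riemann (unsplitK (inl a)); case: (fintype.split _). Qed.

Lemma cone_riemann_ind u (P : 'M[R]_(1 + d) -> Prop) : P 0 ->
  (forall a b, P (curvature (cone_form g nabla) c u a b)) ->
  forall A B, P (cone_riemann u A B).
Proof.
by move=> P0 Pc A B; rewrite /cone_riemann; case: (fintype.split _) => // a;
  case: (fintype.split _).
Qed.

Lemma cone_curvatureE u a b i j : cone_curvature g nabla c u a b i j =
  curvature nabla c u a b i j - (i == a)%:R * g c u b j + (i == b)%:R * g c u a j.
Proof. by rewrite -!delta_mul_row -oppmxE -!add_mxE. Qed.

Lemma einstein u : U u -> forall b e,
  ricci nabla c u b e = d%:R * g c u b e - g c u b e.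
Proof.
move=> Uu b e.
have sX := sasaki3_1 s3; have sY := sasaki3_2 s3; have sZ := sasaki3_3 s3.
have orth v : U v -> inner g X Y c v = 0.
  by move=> Uv; have [] := sasaki3_orthogonal s3 Uv.
have br v : U v -> lie_bracket X Y c v = - 2 *: Z c v.
  by move=> Uv; have [] := sasaki3_bracket s3 Uv.
have sF := smooth_cone_form c lc gm.
have comm W : is_sasaki g nabla W -> forall A B,
    cone_riemann u A B *m cone_endo g nabla W c u =
    cone_endo g nabla W c u *m cone_riemann u A B.
  move=> sW; apply: (@cone_riemann_ind u (fun F => F *m _ = _ *m F)).
    by rewrite mul0mx mulmx0.
  move=> a' b'; apply: curvature_endomorphism => //.
    exact: (smooth_cone_endo lc gm (smooth_killing c (sasaki_killing sW))).
  exact: cone_endo_parallel.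
have flat : forall B E, \sum_C cone_riemann u C B C E = 0.
  apply: (@hyperkahler_ricci_flat _ _ _ _ _ (cone_endo g nabla X c u)
    (cone_endo g nabla Y c u) (cone_endo g nabla Z c u)).
  - move=> A B; rewrite /cone_riemann.
    case: (fintype.split A) => a; case: (fintype.split B) => b';
      rewrite ?oppr0// /curvature; mx_ring.
  (* If one of the cyclic indices is radial, two of the three terms have a radial argument and the
     third lies in the zero column of the block. *)
  - move=> A B C E; case: (split_ordP A) => a ->; case: (split_ordP B) => b' ->;
    case: (split_ordP E) => e' ->; rewrite ?(cone_riemannl, cone_riemannr);
    case: (split_ordP C) => f ->; rewrite ?cone_riemannE//
      ?(block_mxEul, block_mxEur, block_mxEdl, block_mxEdr) ?zeromxE ?addr0//.
    exact: cone_bianchi.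
  - exact: cone_endo_sq.
  - exact: cone_endo_sq.
  - exact: cone_endo_sq.
  - exact: cone_endo_mul.
  - exact: comm.
  - exact: comm.
  - apply: (@cone_riemann_ind u (fun F => \tr F = 0)); first by rewrite mxtrace0.
    move=> a' b'; apply: (mxtrace_skew (cone_metric_unit Uu)).
    apply: curvature_bilinear => //; first exact: smooth_cone_metric.
    by move=> v a'' Uv; exact: cone_metric_parallel.
(* In the contraction the radial index contributes 0, and the two metric terms of [cone_curvature]
   contribute [- d g] and [+ g]. *)
have := flat (rshift 1 b) (rshift 1 e).
rewrite big_split_ord /= big_ord1 cone_riemannl mxE add0r.
under eq_bigr => f _.
  rewrite cone_riemannE// block_mxEdr cone_curvatureE eqxx mul1r.
  over.
rewrite !big_split /= sumr_const card_ord [X in _ + X = 0](bigD1 b)//= eqxx mul1r.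
rewrite [X in _ + (_ + X) = 0]big1 ?addr0; last by move=> f fb; rewrite (negPf fb) mul0r.
rewrite mulNrn -/(ricci nabla c u b e) => /eqP.
by rewrite -addrA addr_eq0 => /eqP ->; rewrite opprD opprK mulr_natl.
Qed.

End Einstein.

(** Here the Ricci tensor is n g, hence symmetric, and the two weights in the Schouten tensor add up
    to n + 2; with the prefactor 1/(n(n + 2)) this leaves g. *)
Lemma schouten_einstein (R : realType) n (M : smooth_manifold R n.+1)
    (g : local_field M 'M[R]_n.+1) (nabla : connection_form M n.+1) c u :
  (0 < n)%N -> (g c u)^T = g c u ->
  (forall b e, ricci nabla c u b e = n.+1%:R * g c u b e - g c u b e) ->
  forall a b, schouten nabla c u a b = g c u a b.
Proof.
move=> n0 gt ric a b; have gs : g c u b a = g c u a b by rewrite -{1}gt mxE.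
rewrite /schouten !ric gs -[in n.+1%:R]addn1 !natrM !natrD.
have nz : n%:R != 0 :> R by rewrite pnatr_eq0 -lt0n.
have nz2 : n%:R + 2 != 0 :> R by rewrite -natrD pnatr_eq0 addn2.
by field; rewrite nz nz2.
Qed.

(** * Projective invariance of the tractor connection *)

Lemma scalemxE (R : pzSemiRingType) m n x (A : 'M[R]_(m, n)) i j :
  (x *: A) i j = x * A i j.
Proof. by rewrite mxE. Qed.

Section Splitting.
Variables (R : realType) (n : nat) (M : smooth_manifold R n.+1).
Variables (nabla : connection_form M n.+1) (c : chart M).
Hypothesis sn : forall a, smooth_mx_on (chart_image c) (fun u => nabla c u a).
Implicit Types (u : 'rV[R]_n.+1) (a b : 'I_n.+1).

Let U := chart_image c.
Let oU : open U := @coord_open _ _ M c.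

Lemma smooth_density_form w a : smooth_on U (fun u => density_form w nabla c u a).
Proof.
apply: (smooth_onM oU); first exact: smooth_on_cst.
by apply: (smooth_on_sum oU) => i; exact: sn.
Qed.

Lemma smooth_density_col w : smooth_mx_on U (fun u => \col_b density_form w nabla c u b).
Proof.
move=> b j; apply: (smooth_on_eq oU) (smooth_density_form w b) => v _.
by rewrite mxE.
Qed.

Lemma smooth_splitting : smooth_mx_on U (splitting nabla c).
Proof.
by apply: (smooth_block_mx oU); try exact: smooth_mx_cst; exact: smooth_density_col.
Qed.

End Splitting.

Lemma unitriangular_unit (R : comUnitRingType) n (v : 'cV[R]_n) :
  block_mx (1%:M : 'M[R]_1) 0 v 1%:M \in unitmx.
Proof. by rewrite unitmxE det_lblock !det1 mulr1 unitr1. Qed.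

Section ProjectiveChange.
Variables (R : realType) (n : nat) (M : smooth_manifold R n.+1).
Variables (nabla nabla' : connection_form M n.+1) (c : chart M).
Variable upsilon : 'rV[R]_n.+1 -> 'cV[R]_n.+1.
Hypothesis n_gt0 : (0 < n)%N.
Hypothesis tf : torsion_free nabla.
Hypothesis sn : forall a, smooth_mx_on (chart_image c) (fun u => nabla c u a).
Hypothesis su : smooth_mx_on (chart_image c) upsilon.
Hypothesis pe : forall u a b e, chart_image c u -> nabla' c u a e b =
  nabla c u a e b + (e == b)%:R * upsilon u a 0 + (e == a)%:R * upsilon u b 0.
Implicit Types (u : 'rV[R]_n.+1) (a b : 'I_n.+1).

Let U := chart_image c.
Let oU : open U := @coord_open _ _ M c.

Lemma proj_changeE u a : U u -> nabla' c u a =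
  nabla c u a + (upsilon u a 0)%:M + delta_mx a (0 : 'I_1) *m (upsilon u)^T.
Proof.
move=> Uu; apply/matrixP => i j; rewrite pe// !add_mxE; congr (_ + _ + _).
  by rewrite mxE mulrC mulr_natr.
by rewrite mxE big_ord1 !mxE eqxx andbT.
Qed.

(* nabla_a Upsilon_b - Upsilon_a Upsilon_b, as a row indexed by b. *)
Definition schouten_change u a : 'rV[R]_n.+1 :=
  (pd_mx a upsilon u)^T - (upsilon u)^T *m nabla c u a
  - upsilon u a 0 *: (upsilon u)^T.

(** The products [nabla c u a *m delta_mx b 0] cancel by torsion-freeness, and the rank-one matrices
    multiply to scalar multiples of themselves, which supply the quadratic part of
    [schouten_change]. *)
Lemma curvature_proj_change u a b : U u -> curvature nabla' c u a b =
  curvature nabla c u a b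
  + (pd a (fun v => upsilon v b 0) u - pd b (fun v => upsilon v a 0) u)%:M
  + delta_mx b (0 : 'I_1) *m schouten_change u a
  - delta_mx a (0 : 'I_1) *m schouten_change u b.
Proof.
move=> Uu; have pdn x y : pd_mx x (fun v => nabla' c v y) u =
    pd_mx x (fun v => nabla c v y) u + (pd x (fun v => upsilon v y 0) u)%:M
    + delta_mx y (0 : 'I_1) *m (pd_mx x upsilon u)^T.
  have s1 : smooth_mx_on U (fun v => (upsilon v y 0)%:M : 'M[R]_n.+1).
    by apply: (smooth_scalar_mx oU); exact: su.
  have s2 : smooth_mx_on U (fun v => delta_mx y (0 : 'I_1) : 'cV[R]_n.+1).
    exact: smooth_mx_cst.
  have s3 := smooth_mx_tr oU su.
  rewrite (pd_mx_eq_on oU x Uu (fun v Uv => proj_changeE y Uv)).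
  rewrite (pd_mxD oU x (smooth_mxD oU (sn y) s1) (smooth_mxM oU s2 s3) Uu).
  rewrite (pd_mxD oU x (sn y) s1 Uu) (pd_mxM oU x s2 s3 Uu) pd_mx_cst mul0mx add0r.
  rewrite pd_mx_tr; congr (_ + _ + _); apply/matrixP => i j; rewrite !mxE.
  have [->|ij] := eqVneq i j.
    by rewrite mulr1n; congr pd; apply/funext => v; rewrite mxE eqxx.
  by rewrite mulr0n -[RHS](pd_cst 0 x u); congr pd; apply/funext => v;
    rewrite mxE (negPf ij).
rewrite /curvature !pdn !proj_changeE//.
have uE x : (upsilon u)^T *m delta_mx x (0 : 'I_1) = (upsilon u x 0)%:M.
  by apply/matrixP => i j; rewrite -colE !mxE !ord1.
have T : nabla c u a *m delta_mx b (0 : 'I_1) = nabla c u b *m delta_mx a 0.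
  by apply/matrixP => i j; rewrite -!colE !mxE; exact: tf.
have D x y : delta_mx x (0 : 'I_1) *m (upsilon u)^T *m (delta_mx y (0 : 'I_1) *m (upsilon u)^T)
    = upsilon u y 0 *: (delta_mx x (0 : 'I_1) *m (upsilon u)^T).
  by rewrite -mulmxA (mulmxA _ (delta_mx y 0)) uE mul_scalar_mx -scalemxAr.
rewrite !(mulmxDl, mulmxDr) !D !mul_scalar_mx !mul_mx_scalar !mulmxA T.
rewrite ?(mulmxDl, mulmxDr, mulNmx, mulmxN) ?mulmxA -?scalemxAr.
apply/matrixP => i j; rewrite !(add_mxE, oppmxE, scalemxE) [_%:M i j]mxE [(_ - _)%:M i j]mxE.
rewrite [(pd b _ u)%:M i j]mxE [(upsilon u a 0)%:M i j]mxE [(upsilon u b 0)%:M i j]mxE.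
move: (pd_mx a (fun v => nabla c v b) u i j) (pd_mx b (fun v => nabla c v a) u i j).
move: (pd a _ u) (pd b _ u).
move: ((delta_mx b 0 *m (pd_mx a upsilon u)^T) i j).
move: ((delta_mx a 0 *m (pd_mx b upsilon u)^T) i j).
move: ((nabla c u a *m nabla c u b) i j) ((nabla c u b *m nabla c u a) i j).
move: ((nabla c u b *m delta_mx a 0 *m (upsilon u)^T) i j).
move: ((delta_mx a 0 *m (upsilon u)^T *m nabla c u b) i j).
move: ((delta_mx b 0 *m (upsilon u)^T *m nabla c u a) i j).
move: ((delta_mx a 0 *m (upsilon u)^T) i j) ((delta_mx b 0 *m (upsilon u)^T) i j).
move: (upsilon u a 0) (upsilon u b 0) (nabla c u a i j) (nabla c u b i j).
by case: (i == j) => *; rewrite ?mulr1n ?mulr0n; ring.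
Qed.

Lemma ricci_proj_change u a b : U u -> ricci nabla' c u a b =
  ricci nabla c u a b + schouten_change u b 0 a - n.+1%:R * schouten_change u a 0 b.
Proof.
move=> Uu.
have E x y i j : curvature nabla' c u x y i j = curvature nabla c u x y i j
    + (i == j)%:R * (schouten_change u x 0 y - schouten_change u y 0 x)
    + (i == y)%:R * schouten_change u x 0 j - (i == x)%:R * schouten_change u y 0 j.
  have dq (v w : 'I_n.+1) : (delta_mx v (0 : 'I_1) *m schouten_change u w) i j =
      (i == v)%:R * schouten_change u w 0 j.
    by rewrite mxE big_ord1 mxE eqxx andbT.
  rewrite curvature_proj_change// [LHS]add_mxE oppmxE add_mxE add_mxE !dq.
  (* The exterior derivative of Upsilon is the skew part of [schouten_change], whose Christoffel and
     quadratic terms are symmetric. *)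
  congr (_ + _ + _ + _); rewrite [LHS]mxE [RHS]mulr_natl; congr (_ *+ _).
  rewrite /schouten_change !(add_mxE, oppmxE, scalemxE).
  have -> : ((upsilon u)^T *m nabla c u x) 0 y = ((upsilon u)^T *m nabla c u y) 0 x.
    by rewrite !mxE; apply: eq_bigr => w _; rewrite tf.
  rewrite ![_^T _ _]mxE ![pd_mx _ _ _ _ _]mxE.
  move: (pd x _ u) (pd y _ u) ((_ *m _) _ _) (upsilon u x 0) (upsilon u y 0) => *.
  by ring.
rewrite /ricci; under eq_bigr do rewrite E eqxx mul1r.
have delta_sum (v : 'I_n.+1) (f : 'I_n.+1 -> R) : \sum_i (i == v)%:R * f i = f v.
  rewrite (bigD1 v)//= eqxx mul1r big1 ?addr0// => w wv.
  by rewrite (negPf wv) mul0r.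
rewrite !big_split /= sumr_const card_ord !delta_sum mulNrn -[_ *+ n.+1]mulr_natl.
move: (\sum_(i < n.+1) _) (schouten_change u a 0 b) (schouten_change u b 0 a).
by move=> *; ring.
Qed.

(** The weights n + 1 and 1 cancel the transposed term of the Ricci change and leave the factor 1 -
    (n + 1)^2 = - n(n + 2). *)
Lemma schouten_proj_change u a b : U u -> schouten nabla' c u a b =
  schouten nabla c u a b - schouten_change u a 0 b.
Proof.
move=> Uu; rewrite /schouten !ricci_proj_change//.
move: (ricci _ _ _ _ _) (ricci _ _ _ _ _) (schouten_change u a 0 b) (schouten_change u b 0 a).
move=> x y z w; rewrite -(natr1 n) natrM !natrD.
have nz : n%:R != 0 :> R by rewrite pnatr_eq0 -lt0n.
have nz2 : n%:R + 2 != 0 :> R by rewrite -natrD pnatr_eq0 addn2.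
by field; rewrite nz nz2.
Qed.

(** The trace of the connection changes by n + 1 copies of Upsilon from the scalar term and one from
    the rank-one term, whence the normalisation by n + 2. *)
Lemma density_proj_change u a : U u -> density_form 1 nabla' c u a =
  density_form 1 nabla c u a + upsilon u a 0.
Proof.
move=> Uu; rewrite /density_form proj_changeE// !mxtraceD mxtrace_scalar.
rewrite mxtrace_mulC -colE (_ : \tr (col a _) = upsilon u a 0); last first.
  by rewrite /mxtrace big_ord1 !mxE.
rewrite -[upsilon u a 0 *+ _]mulr_natl -(natr1 n) natrD.
have nz2 : n%:R + 2 != 0 :> R by rewrite -natrD pnatr_eq0 addn2.
by move: (upsilon u a 0) (\tr _) => x y; field; rewrite nz2.
Qed.

Let change u : 'M[R]_(1 + n.+1) := block_mx 1%:M 0 (upsilon u) 1%:M.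

Lemma splitting_proj_change u : U u ->
  splitting nabla' c u = change u *m splitting nabla c u.
Proof.
move=> Uu; rewrite mulmx_block !(mul1mx, mulmx1, mul0mx, mulmx0, addr0, add0r).
congr block_mx; apply/matrixP => i j.
by rewrite (ord1 j) !mxE density_proj_change// addrC.
Qed.

(** The gauge equation for [change], which compares the two splittings. In the lower left block the
    derivative of Upsilon is compensated by the change of the Schouten tensor. *)
Lemma split_form_proj_change u a : U u ->
  pd_mx a change u + split_cotractor_form nabla' c u a *m change u =
  change u *m split_cotractor_form nabla c u a.
Proof.
move=> Uu; rewrite pd_block_mx !pd_mx_cst /split_cotractor_form !mulmx_block.
rewrite !(mul1mx, mulmx1, mul0mx, mulmx0, addr0, add0r) add_block_mx !add0r.
have -> : dual_form nabla' c u a + (density_form 1 nabla' c u a)%:M =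
    - (nabla c u a)^T + (density_form 1 nabla c u a)%:M - upsilon u *m delta_mx 0 a.
  rewrite density_proj_change// /dual_form proj_changeE// !linearD /= tr_scalar_mx.
  by rewrite trmx_mul trmxK trmx_delta (raddfD (@scalar_mx R n.+1)) /=; mx_ring.
rewrite density_proj_change//; congr block_mx.
- apply/matrixP => i j; rewrite !ord1 mulNmx -rowE !mxE.
  by rewrite addrK.
- apply/matrixP => i j; rewrite !ord1 [LHS]add_mxE [in LHS]add_mxE [RHS]add_mxE.
  rewrite ![(\col_b _) _ _]mxE schouten_proj_change// mul_mx_scalar scalemxE.
  rewrite !mulmxDl !mulNmx mul_scalar_mx !(add_mxE, oppmxE, scalemxE).
  rewrite -mulmxA -rowE [(upsilon u *m _) i 0]mxE big_ord1 [row _ _ _ _]mxE.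
  rewrite ?/schouten_change ?(add_mxE, oppmxE, scalemxE).
  have -> : ((upsilon u)^T *m nabla c u a) 0 i = ((nabla c u a)^T *m upsilon u) i 0.
    by rewrite -[nabla c u a in LHS]trmxK -trmx_mul [LHS]mxE.
  rewrite ![_^T 0 i]mxE [pd_mx a upsilon u i 0]mxE -[ord0]/(0 : 'I_1).
  move: (pd a _ u) (schouten _ _ _ _ _) ((_ *m _) i 0).
  by move: (upsilon u a 0) (upsilon u i 0) (density_form _ _ _ _ _) => *; ring.
- by rewrite /dual_form mulmxN; mx_ring.
Qed.

(** In jet components the form is the gauge transform of the split one by [splitting]. Passing to
    the other connection multiplies [splitting] by [change], and the two gauge transforms
    compose. *)
Lemma cotractor_proj_change u a : U u ->
  cotractor_form nabla' c u a = cotractor_form nabla c u a.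
Proof.
move=> Uu; have sS := smooth_splitting sn.
have sC : smooth_mx_on U change.
  by apply: (smooth_block_mx oU) => //; exact: smooth_mx_cst.
have uS : splitting nabla c u \in unitmx by exact: unitriangular_unit.
have uC : change u \in unitmx by exact: unitriangular_unit.
rewrite /cotractor_form (pd_mx_eq_on oU a Uu splitting_proj_change).
rewrite (pd_mxM oU a sC sS Uu) splitting_proj_change//.
rewrite addrAC mulmxA -mulmxDl split_form_proj_change// -mulmxA -mulmxDr addrC.
set D := _ + _; have uCS : change u *m splitting nabla c u \in unitmx.
  by rewrite unitmx_mul uC.
rewrite -[LHS](mulKmx uS) -[RHS](mulKmx uS); congr (_ *m _).
rewrite -[LHS](mulKmx uC) -[RHS](mulKmx uC); congr (_ *m _).
by rewrite !mulmxA mulmxV// mul1mx -!mulmxA mulKVmx.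
Qed.

End ProjectiveChange.

(** * The tractor bundle in the scale of the metric *)

(** A directional derivative at [x] is the derivative at 0 of a function of one real variable, so
    the one-variable chain rule suffices. *)
Lemma is_derive_comp_real (R : realType) (V : normedModType R) (f : V -> R)
    (h : R -> R) (x v : V) (df dh : R) :
  is_derive x v f df -> is_derive (f x) (1 : R) h dh ->
  is_derive x v (h \o f) (dh * df).
Proof.
have E (F : V -> R) : (fun s : R => s^-1 *: ((F \o shift x) (s *: v) - F x)) =
    (fun s : R => s^-1 *: (((fun t : R => F (t *: v + x)) \o shift 0) (s *: 1)
      - F (0 *: v + x))).
  by apply/funext => s /=; rewrite addr0 scale0r add0r [s%:A]mulr1.
move=> [df1 df2] dhx.
have dphi : is_derive (0 : R) 1 (fun t : R => f (t *: v + x)) df.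
  by split; [rewrite /derivable -E|rewrite /derive -E].
have dhx' : is_derive (f ((0 : R) *: v + x)) 1 h dh by rewrite scale0r add0r.
have [c1 c2] := is_derive1_comp dhx' dphi.
by split; [rewrite /derivable E|rewrite /derive E]; [exact: c1|rewrite -c2].
Qed.

Lemma is_derive_powR (R : realType) d (U : set 'rV[R]_d) (f : 'rV[R]_d -> R) (r : R) a u :
  smooth_on U f -> U u -> 0 < f u ->
  is_derive u (delta_mx 0 a : 'rV[R]_d) (fun v => f v `^ r)
    (r * f u `^ (r - 1) * pd a f u).
Proof.
move=> sf Uu f0; apply: (is_derive_comp_real (h := fun x => x `^ r)).
  by apply: derivableP; exact: smooth_on_derivable.
exact: is_derive1_powR.
Qed.

Section Frame.
Variables (R : realType) (n : nat) (M : smooth_manifold R n.+1).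
Variables (g : local_field M 'M[R]_n.+1) (nabla : connection_form M n.+1).
Hypothesis lc : is_levi_civita g nabla.
Hypothesis gm : is_metric g.
Implicit Types (u : 'rV[R]_n.+1) (a b : 'I_n.+1) (c : chart M).

(* The power of the volume density that is a parallel section of E(1). *)
Definition scale c u : R :=
  (\det (g c u) ^+ 2) `^ (- (1 / (2 * n + 4)%:R / 2)).

Definition density_cov c u : 'cV[R]_n.+1 := \col_b density_form 1 nabla c u b.

(** At [density_cov] this is the transpose of [splitting], so at [- density_cov] it is the splitting
    acting on the dual components. *)
Definition unipotent (w : 'cV[R]_n.+1) : 'M[R]_(1 + n.+1) :=
  block_mx 1%:M w^T 0 1%:M.

(* The scale splits the tractor bundle as R + TM; this matrix maps the
   components of a tractor to those of its image. *)
Definition frame c u : 'M[R]_(1 + n.+1) := scale c u *: unipotent (- density_cov c u).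

Lemma unipotentK w : unipotent w *m unipotent (- w) = 1%:M.
Proof.
rewrite mulmx_block !(mul1mx, mulmx1, mul0mx, mulmx0, addr0, add0r) trmx_opp addNr.
by rewrite -scalar_mx_block.
Qed.

Lemma unipotentVK w : unipotent (- w) *m unipotent w = 1%:M.
Proof. by rewrite -{2}[w]opprK unipotentK. Qed.

Lemma det_metric_sq_gt0 c u : chart_image c u -> 0 < \det (g c u) ^+ 2.
Proof.
move=> Uu; rewrite lt_def sqr_ge0 andbT expf_neq0//.
by have := metric_unit gm Uu; rewrite unitmxE unitfE.
Qed.

Lemma scale_gt0 c u : chart_image c u -> 0 < scale c u.
Proof. by move=> Uu; rewrite powR_gt0// det_metric_sq_gt0. Qed.

Lemma frame_unit c u : chart_image c u -> frame c u \in unitmx.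
Proof.
move=> Uu; rewrite unitmxZ ?unitfE ?gt_eqF ?scale_gt0//.
by have [] := mulmx1_unit (unipotentVK (density_cov c u)).
Qed.

Section OneChart.
Variable c : chart M.
Let U := chart_image c.
Let oU : open U := @coord_open _ _ M c.

Lemma smooth_density_cov : smooth_mx_on U (density_cov c).
Proof. exact: (smooth_density_col (smooth_lc c lc)). Qed.

Lemma smooth_unipotent (w : 'rV[R]_n.+1 -> 'cV[R]_n.+1) :
  smooth_mx_on U w -> smooth_mx_on U (fun u => unipotent (w u)).
Proof.
move=> sw; apply: (smooth_block_mx oU); try exact: smooth_mx_cst.
exact: smooth_mx_tr.
Qed.

(** By Jacobi's formula and metric compatibility the logarithmic derivative of det g is twice the
    trace of [nabla], hence four times it for the squared determinant; the exponent -1/(4(n + 2))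
    turns this into minus the connection form of E(1). *)
Lemma is_derive_scale a u : U u ->
  is_derive u (delta_mx 0 a : 'rV[R]_n.+1) (scale c)
    (- (density_cov c u a 0 * scale c u)).
Proof.
move=> Uu; have sg := smooth_metric c gm; have sd := smooth_on_det oU sg.
have sd2 : smooth_on U (fun v => \det (g c v) ^+ 2).
  exact: (smooth_onM oU sd sd).
apply: is_derive_eq (is_derive_powR _ a sd2 Uu (det_metric_sq_gt0 Uu)) _.
have D0 := det_metric_sq_gt0 Uu.
have -> : pd a (fun v => \det (g c v) ^+ 2) u = \det (g c u) ^+ 2 * (4 * \tr (nabla c u a)).
  have -> : (fun v => \det (g c v) ^+ 2) = (fun v => \det (g c v)) \* (fun v => \det (g c v)).
    by apply/funext => v; rewrite expr2.
  rewrite (pdM a sd sd Uu) (pd_det oU a sg Uu) (pd_metric lc a Uu) mulmxDl mxtraceD.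
  rewrite -mulmxA mul_mx_adj mul_mx_scalar mxtraceZ mxtrace_tr.
  rewrite [\tr (g c u *m _ *m _)]mxtrace_mulC mulmxA mul_adj_mx mul_scalar_mx mxtraceZ.
  by move: (\tr _) (\det _) => x y; ring.
rewrite mxE /density_form /scale.
set r := - _.
have -> : (\det (g c u) ^+ 2) `^ r =
    (\det (g c u) ^+ 2) `^ (r - 1) * \det (g c u) ^+ 2.
  rewrite mulrC -[X in X * _]powRr1 ?ltW// -powRD; last first.
    by apply/implyP => _; rewrite gt_eqF.
  by congr (_ `^ _); ring.
rewrite /r; have nz : n%:R + 2 != 0 :> R by rewrite -natrD pnatr_eq0 addn2.
have -> : (2 * n + 4)%:R = 2 * (n%:R + 2) :> R by rewrite natrD natrM; ring.
have -> : (n + 2)%:R = n%:R + 2 :> R by rewrite natrD.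
suff alg (x y z m : R) : m + 2 != 0 -> - (1 / (2 * (m + 2)) / 2) * x * (z * (4 * y))
    = - (1 / (m + 2) * y * (x * z)) by exact: alg.
by move=> m0; field.
Qed.

Lemma pd_scale a u : U u -> pd a (scale c) u = - (density_cov c u a 0 * scale c u).
Proof. by move=> Uu; have [] := is_derive_scale a Uu. Qed.

(* The equation pd scale = - density_cov * scale propagates smoothness. *)
Lemma smooth_scale : smooth_on U (scale c).
Proof.
have C0 u : U u -> {for u, continuous (scale c)}.
  move=> Uu; have sd := smooth_on_det oU (smooth_metric c gm) 0%N.
  apply: (@continuous_comp _ _ _ (fun v => \det (g c v) ^+ 2) (fun x => x `^ _)).
    by apply: continuousM; exact: sd.
  apply: differentiable_continuous; apply/derivable1_diffP.
  by have [] := is_derive1_powR (- (1 / (2 * n + 4)%:R / 2)) (det_metric_sq_gt0 Uu).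
(* In the bootstrap one factor is known only up to order [k], so the product rule is stated with
   finite order for that factor. *)
have CkM k (f h : 'rV[R]_n.+1 -> R) : smooth_on U f -> Ck_on k U h ->
    (forall l, (l <= k)%N -> Ck_on l U h) -> Ck_on k U (f \* h).
  elim: k f h => [|k IH] f h sf Ch Cl /=.
    by move=> u Uu; apply: continuousM; [exact: (sf 0%N)|exact: Ch].
  have [dh Ch'] := Ch; split=> [a u Uu|a].
    by apply: derivableM; [exact: smooth_on_derivable|exact: dh].
  apply: (@Ck_on_eq _ _ _ oU _ ((pd a f \* h) \+ (f \* pd a h))).
    move=> u Uu; rewrite [RHS]deriveM; [|exact: smooth_on_derivable|exact: dh].
    by rewrite addrC [h u *: _]mulrC.
  apply: (Ck_onD oU).
    apply: IH; [exact: smooth_on_pd|exact: (Cl k (leqnSn k))|].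
    by move=> l lk; apply: Cl; exact: leqW.
  apply: IH => //; first exact: Ch'.
  by move=> l lk; have [_] := Cl l.+1 lk; exact.
suff Cl k : forall l, (l <= k)%N -> Ck_on l U (scale c) by move=> k; exact: (Cl k).
elim: k => [|k IH] l; first by rewrite leqn0 => /eqP ->; exact: C0.
rewrite leq_eqVlt => /orP[/eqP ->|]; last exact: IH.
split=> [a u Uu|a]; first by have [] := is_derive_scale a Uu.
have sw : smooth_on U (fun u => - density_cov c u a 0).
  by apply: (smooth_onN oU); exact: smooth_density_cov.
apply: (Ck_on_eq oU _ (CkM k _ _ sw (IH k (leqnn k)) IH)) => u Uu.
by rewrite pd_scale//= mulNr.
Qed.

Lemma smooth_frame : smooth_mx_on U (frame c).
Proof.
apply: (smooth_mxZ oU smooth_scale); apply: smooth_unipotent.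
by apply: (smooth_mxN oU); exact: smooth_density_cov.
Qed.

Hypothesis schoutenE : forall u a b, U u -> schouten nabla c u a b = g c u a b.

(** With Schouten tensor [g], the split cotractor connection is the dual of the cone connection
    twisted by the connection of E(1); only that scalar twist remains. *)
Lemma split_cotractor_cone u a : U u ->
  split_cotractor_form nabla c u a + (cone_form g nabla c u a)^T = (density_cov c u a 0)%:M.
Proof.
move=> Uu; rewrite tr_block_mx add_block_mx [RHS]scalar_mx_block.
have -> : density_cov c u a 0 = density_form 1 nabla c u a by rewrite mxE.
congr block_mx.
- by rewrite trmx0 addr0.
- by rewrite trmx_delta addNr.
- rewrite trmx_opp; apply/matrixP => b j; rewrite !mxE schoutenE//.
  by rewrite subrr.
- by rewrite /dual_form addrC addrA subrr add0r.
Qed.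

(** This says that [frame] is a parallel map from the tractor connection to the cone connection: the
    derivative of [scale] cancels the scalar twist. *)
Lemma pd_frame u a : U u -> pd_mx a (frame c) u =
  frame c u *m tractor_form nabla c u a - cone_form g nabla c u a *m frame c u.
Proof.
move=> Uu; have sS := smooth_splitting (smooth_lc c lc).
have sFt := smooth_mx_tr oU smooth_frame.
have uS : splitting nabla c u \in unitmx by exact: unitriangular_unit.
(* Differentiating this relation expresses the derivative of [frame] through those of [splitting]
   and [scale], both of which occur in the goal. *)
have SF v : splitting nabla c v *m (frame c v)^T = (scale c v)%:M.
  rewrite /frame linearZ /= -scalemxAr /splitting -/(density_cov c v) tr_block_mx trmxK.
  rewrite mulmx_block !(trmx0, trmx1, mul1mx, mulmx1, mul0mx, mulmx0, addr0, add0r).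
  by rewrite subrr -scalar_mx_block scalemx1.
have := pd_mx_eq_on oU a Uu (fun v _ => SF v).
rewrite (pd_mxM oU a sS sFt Uu).
have -> : pd_mx a (fun v => (scale c v)%:M : 'M[R]_(1 + n.+1)) u = (pd a (scale c) u)%:M.
  apply/matrixP => i j; rewrite !mxE; have [->|ij] := eqVneq i j.
    by rewrite mulr1n; congr pd; apply/funext => v; rewrite mxE eqxx.
  rewrite mulr0n -[RHS](pd_cst 0 a u); congr pd; apply/funext => v.
  by rewrite mxE (negPf ij).
rewrite pd_scale// => h; apply: trmx_inj; rewrite -pd_mx_tr.
rewrite -[LHS](mulKmx uS) -[RHS](mulKmx uS); congr (_ *m _).
have -> : splitting nabla c u *m pd_mx a (fun v => (frame c v)^T) u =
    (- (density_cov c u a 0 * scale c u))%:M - pd_mx a (splitting nabla c) u *m (frame c u)^T.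
  by rewrite -h addrC addKr.
have W : (density_cov c u a 0 * scale c u)%:M = scale c u *: split_cotractor_form nabla c u a
    + splitting nabla c u *m (frame c u)^T *m (cone_form g nabla c u a)^T.
  rewrite SF mul_scalar_mx -scalerDr split_cotractor_cone//.
  by rewrite mulrC -scale_scalar_mx.
have -> : (- (density_cov c u a 0 * scale c u))%:M = - (density_cov c u a 0 * scale c u)%:M
    :> 'M[R]_(1 + n.+1) by apply/matrixP => i j; rewrite !mxE mulNrn.
rewrite W linearB /= /tractor_form /dual_form /cotractor_form mulmxN trmx_opp.
rewrite !trmx_mul !trmxK mulmxBr mulmxN !mulmxA mulmxV// mul1mx.
rewrite mulmxDl -(mulmxA _ (splitting _ _ _)) SF mul_mx_scalar.
by move: (_ *: _) => A; mx_ring.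
Qed.

Definition tractor_metric : local_field M 'M[R]_(1 + n.+1) := fun c u =>
  (frame c u)^T *m cone_metric g c u *m frame c u.

(** Conjugation by [frame]; the scalar [scale] cancels and only the unipotent factors remain. *)
Definition tractor_endo (E : local_field M 'M[R]_(1 + n.+1)) :
    local_field M 'M[R]_(1 + n.+1) := fun c u =>
  unipotent (density_cov c u) *m E c u *m unipotent (- density_cov c u).

Lemma frame_tractor_endo E u : 
  frame c u *m tractor_endo E c u = E c u *m frame c u.
Proof.
by rewrite -scalemxAl !mulmxA unipotentVK mul1mx -scalemxAr.
Qed.

Lemma smooth_tractor_metric : smooth_mx_on U (tractor_metric c).
Proof.
apply: (smooth_mxM oU) smooth_frame; apply: (smooth_mxM oU).
  by apply: (smooth_mx_tr oU); exact: smooth_frame.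
exact: smooth_cone_metric.
Qed.

Lemma smooth_tractor_endo E : smooth_mx_on U (E c) -> smooth_mx_on U (tractor_endo E c).
Proof.
move=> sE; apply: (smooth_mxM oU).
  by apply: (smooth_mxM oU) => //; apply: smooth_unipotent; exact: smooth_density_cov.
by apply: smooth_unipotent; apply: (smooth_mxN oU); exact: smooth_density_cov.
Qed.

Lemma tractor_metric_parallel u a : U u ->
  nabla_bilinear (tractor_form nabla) tractor_metric c u a = 0.
Proof.
move=> Uu; have sF := smooth_frame; have sFt := smooth_mx_tr oU sF.
have sH := smooth_cone_metric c gm; have sFH := smooth_mxM oU sFt sH.
have := cone_metric_parallel lc gm a Uu; rewrite /nabla_bilinear => h.
rewrite (pd_mxM oU a sFH sF Uu) (pd_mxM oU a sFt sH Uu) pd_mx_tr pd_frame//.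
(* The zero on the right is written as the pullback by [frame] of the vanishing derivative of the
   cone metric. *)
rewrite linearB /= !trmx_mul -(mul0mx _ (frame c u)) -(mulmx0 _ (frame c u)^T) -h.
by rewrite /tractor_metric; mx_ring.
Qed.

Lemma tractor_endo_parallel E u a : smooth_mx_on U (E c) ->
  parallel_endo_on (cone_form g nabla) c E -> U u ->
  nabla_endomorphism (tractor_form nabla) (tractor_endo E) c u a = 0.
Proof.
move=> sE pE Uu; have sF := smooth_frame; have sT := smooth_tractor_endo sE.
have := pd_mx_eq_on oU a Uu (fun v _ => frame_tractor_endo E v).
rewrite (pd_mxM oU a sF sT Uu) (pd_mxM oU a sE sF Uu) pd_frame//.
rewrite (pd_parallel_endo a pE Uu) => h.
suff z : frame c u *m nabla_endomorphism (tractor_form nabla) (tractor_endo E) c u a = 0.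
  by rewrite -[LHS](mulKmx (frame_unit Uu)) z mulmx0.
have BE := frame_tractor_endo E u.
move: (tractor_endo E) sT BE h => T sT BE h.
rewrite /nabla_endomorphism mulmxBr mulmxDr !mulmxA BE.
have -> : frame c u *m pd_mx a (T c) u =
    (E c u *m cone_form g nabla c u a - cone_form g nabla c u a *m E c u) *m frame c u
    + E c u *m (frame c u *m tractor_form nabla c u a - cone_form g nabla c u a *m frame c u)
    - (frame c u *m tractor_form nabla c u a - cone_form g nabla c u a *m frame c u)
      *m T c u.
  by rewrite -h addrC addKr.
have TBE : cone_form g nabla c u a *m frame c u *m T c u =
    cone_form g nabla c u a *m E c u *m frame c u by rewrite -!mulmxA BE.
rewrite (mulmxBl _ _ (T c u)) TBE.
by mx_ring.
Qed.

End OneChart.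
End Frame.

(** * Changes of charts *)

Lemma smooth_on_sub (R : realType) d (U V : set 'rV[R]_d) (f : 'rV[R]_d -> R) :
  U `<=` V -> smooth_on V f -> smooth_on U f.
Proof.
move=> UV sf k; elim: k f sf => [|k IH] f sf /=; first by move=> u /UV; exact: (sf 0%N).
by split=> [a u /UV Vu|a]; [exact: smooth_on_derivable|apply: IH; exact: smooth_on_pd].
Qed.

Section Overlap.
Variables (R : realType) (d : nat) (M : smooth_manifold R d) (i j : chart M).
Implicit Types (u : 'rV[R]_d) (a b e : 'I_d).

Lemma overlap_src u : overlap i j u -> chart_image i u.
Proof. by move=> [x [xi xj] <-]; exists x. Qed.

Lemma overlap_tgt u : overlap i j u -> chart_image j (transition i j u).
Proof. by move=> [x [xi xj] <-]; exists x => //; rewrite /transition coordK. Qed.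

Lemma overlap_open : open (overlap i j).
Proof.
rewrite openE => u ou; have iu := overlap_src ou.
have pj : dom j (param i u) by move: ou => [x [xi xj] <-]; rewrite coordK.
have n1 : nbhs u (chart_image i).
  by apply: open_nbhs_nbhs; split=> //; exact: coord_open.
have n2 : nbhs u (param i @^-1` dom j).
  apply: (param_continuous iu); apply: open_nbhs_nbhs; split=> //.
  exact: dom_open.
rewrite /interior; apply: filterS (filterI n1 n2) => v [[x xi <-] /= xj].
by exists x => //; split=> //; rewrite coordK in xj.
Qed.

Lemma smooth_transition : smooth_mx_on (overlap i j) (transition i j).
Proof. exact: transition_smooth. Qed.

Lemma smooth_jacobian : smooth_mx_on (overlap i j) (jacobian_mx i j).
Proof.
move=> b a.
apply: (smooth_on_eq overlap_open) (smooth_on_pd a (smooth_transition 0 b)) => v _.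
by rewrite mxE.
Qed.

Lemma is_derive_transition (f : 'rV[R]_d -> R) u a : smooth_on (chart_image j) f ->
  overlap i j u -> is_derive u (delta_mx 0 a : 'rV[R]_d) (fun v => f (transition i j v))
    (\sum_e jacobian_mx i j u e a * pd e f (transition i j u)).
Proof.
move=> sf ou; have oj := overlap_tgt ou.
have dt : derivable (transition i j) u (delta_mx 0 a).
  apply/derivable_mxP => x b; rewrite (ord1 x).
  by apply: smooth_on_derivable ou; exact: smooth_transition.
have D := is_derive_comp_C1 (@coord_open _ _ M j) oj (smooth_on_C1 sf) dt.
apply: (@is_derive_eq _ _ _ (f \o transition i j) _ _ _ _ D); apply: eq_bigr => e _; congr (_ * _).
by rewrite derive_mx// !mxE.
Qed.

Lemma pd_mx_transition (r s : nat) (F : 'rV[R]_d -> 'M[R]_(r, s)) u a :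
  smooth_mx_on (chart_image j) F -> overlap i j u ->
  pd_mx a (fun v => F (transition i j v)) u =
  \sum_e jacobian_mx i j u e a *: pd_mx e F (transition i j u).
Proof.
move=> sF ou; apply/matrixP => x y; rewrite [LHS]mxE summxE.
have [_ E] := is_derive_transition a (sF x y) ou; rewrite /pd E.
by apply: eq_bigr => e _; rewrite !mxE.
Qed.

Section Metric.
Variables (g : local_field M 'M[R]_d) (nabla : connection_form M d).
Hypothesis lc : is_levi_civita g nabla.
Hypothesis gm : is_metric g.

Lemma metric_transition u : overlap i j u ->
  (jacobian_mx i j u)^T *m g j (transition i j u) *m jacobian_mx i j u = g i u.
Proof. by move=> ou; have [[_ E] _] := gm; exact: E. Qed.

(** The Jacobian is a factor of the nondegenerate matrix [g i u]. *)
Lemma jacobian_unit u : overlap i j u -> jacobian_mx i j u \in unitmx.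
Proof.
move=> ou; have := metric_unit gm (overlap_src ou).
by rewrite -metric_transition// unitmx_mul => /andP[].
Qed.

Lemma vector_transition (X : local_field M 'cV[R]_d) u : is_vector_field X ->
  overlap i j u -> X j (transition i j u) = jacobian_mx i j u *m X i u.
Proof. by move=> [_ E] ou; exact: E. Qed.

(** Tested on basis columns, the derivative of the Jacobian produced by differentiating the
    transformed field combines with the Christoffel term through the transformation law of the
    connection. *)
Lemma nabla_mx_transition (X : local_field M 'cV[R]_d) u : is_vector_field X ->
  overlap i j u ->
  nabla_mx nabla X j (transition i j u) *m jacobian_mx i j u =
  jacobian_mx i j u *m nabla_mx nabla X i u.
Proof.
move=> vX ou; have [sX tX] := vX; have [[_ conn] _ _] := lc.
have si : smooth_mx_on (overlap i j) (X i).
  by move=> x y; apply: smooth_on_sub (sX i x y) => v; exact: overlap_src.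
suff key a : nabla_mx nabla X j (transition i j u) *m jacobian_mx i j u *m delta_mx a (0 : 'I_1) =
    jacobian_mx i j u *m nabla_mx nabla X i u *m delta_mx a 0.
  by apply/matrixP => x y; have /matrixP/(_ x 0) := key y; rewrite -!colE !mxE.
have -> : nabla_mx nabla X j (transition i j u) *m jacobian_mx i j u *m delta_mx a (0 : 'I_1) =
    \sum_e jacobian_mx i j u e a *: (pd_mx e (X j) (transition i j u)
      + nabla j (transition i j u) e *m X j (transition i j u)).
  rewrite -mulmxA -[jacobian_mx i j u *m _]colE.
  have -> : col a (jacobian_mx i j u) = \sum_e jacobian_mx i j u e a *: delta_mx e (0 : 'I_1).
    by rewrite [LHS]matrix_sum_delta; apply: eq_bigr => e _; rewrite big_ord1 mxE.
  by rewrite mulmx_sumr; apply: eq_bigr => e _; rewrite -scalemxAr nabla_mx_delta.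
under eq_bigr do rewrite scalerDr.
rewrite big_split /= -pd_mx_transition//.
have -> : pd_mx a (fun v => X j (transition i j v)) u =
    pd_mx a (fun v => jacobian_mx i j v *m X i v) u.
  by apply: (pd_mx_eq_on overlap_open) => // v ov; exact: vector_transition.
rewrite (pd_mxM overlap_open a smooth_jacobian si ou) vector_transition//.
have := conn i j u a ou; rewrite /tangent_cocycle -/(jacobian_mx i j) => c.
have -> : \sum_e jacobian_mx i j u e a *:
      (nabla j (transition i j u) e *m (jacobian_mx i j u *m X i u)) =
    (\sum_e jacobian_mx i j u e a *:
      (nabla j (transition i j u) e *m jacobian_mx i j u)) *m X i u.
  by rewrite mulmx_suml; apply: eq_bigr => e _; rewrite -scalemxAl mulmxA.
rewrite addrAC -mulmxDl c -!mulmxA -mulmxDr nabla_mx_delta; congr (_ *m _).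
by rewrite addrC.
Qed.

Definition cone_jacobian u : 'M[R]_(1 + d) := block_mx 1%:M 0 0 (jacobian_mx i j u).

Lemma cone_metric_transition u : overlap i j u ->
  (cone_jacobian u)^T *m cone_metric g j (transition i j u) *m cone_jacobian u =
  cone_metric g i u.
Proof.
move=> ou; rewrite tr_block_mx !mulmx_block.
rewrite !(trmx0, trmx1, mul1mx, mulmx1, mul0mx, mulmx0, addr0, add0r).
by rewrite metric_transition.
Qed.

Lemma cone_endo_transition (X : local_field M 'cV[R]_d) u : is_vector_field X ->
  overlap i j u ->
  cone_endo g nabla X j (transition i j u) *m cone_jacobian u =
  cone_jacobian u *m cone_endo g nabla X i u.
Proof.
move=> vX ou; rewrite !mulmx_block.
rewrite !(mul1mx, mulmx1, mul0mx, mulmx0, addr0, add0r).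
rewrite nabla_mx_transition// vector_transition//; congr block_mx.
by rewrite mulNmx -metric_transition// !trmx_mul trmxK !mulmxA.
Qed.

End Metric.
End Overlap.

(** * The frame intertwines the tractor and cone cocycles *)

Section FrameTransition.
Variables (R : realType) (n : nat) (M : smooth_manifold R n.+1).
Variables (g : local_field M 'M[R]_n.+1) (nabla : connection_form M n.+1).
Hypothesis lc : is_levi_civita g nabla.
Hypothesis gm : is_metric g.
Variables (i j : chart M).
Implicit Types (u : 'rV[R]_n.+1) (a b e : 'I_n.+1).

Let J u := jacobian_mx i j u.
Let rho u := density_cocycle (R := R) (n := n) (M := M) 1 i j u.

Lemma det_jacobian_sq_gt0 u : overlap i j u -> 0 < \det (J u) ^+ 2.
Proof.
move=> ou; rewrite lt_def sqr_ge0 andbT expf_neq0//.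
by have := jacobian_unit gm ou; rewrite unitmxE unitfE.
Qed.

(** The squared determinant of the metric picks up the fourth power of det J, twice the power
    occurring in the density cocycle; this is the origin of the extra factor 1/2 in the exponent of
    [scale]. *)
Lemma scale_transition u : overlap i j u ->
  scale g j (transition i j u) = rho u * scale g i u.
Proof.
move=> ou; have D0 := det_jacobian_sq_gt0 ou.
have G0 := det_metric_sq_gt0 gm (overlap_tgt ou).
rewrite /scale /rho /density_cocycle -[g i u](metric_transition gm ou) !det_mulmx det_tr.
set D := \det (J u) in D0 *; set G := \det _ in G0 *.
have -> : (D * G * D) ^+ 2 = (D ^+ 2) ^+ 2 * G ^+ 2 by ring.
rewrite (powRM _ (sqr_ge0 (D ^+ 2)) (sqr_ge0 G)) mulrA -[LHS]mul1r; congr (_ * _).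
rewrite -(powR_mulrn 2 (ltW D0)) -powRrM -powRD; last by apply/implyP => _; rewrite gt_eqF.
by rewrite mulrN [2 * _]mulrC divfK ?pnatr_eq0// subrr powRr0.
Qed.

Lemma derivable_density u a : overlap i j u ->
  derivable rho u (delta_mx 0 a).
Proof.
move=> ou; have oo := @overlap_open _ _ _ i j.
have sJ := smooth_on_det oo (@smooth_jacobian _ _ _ i j).
have [D _] := is_derive_powR (1 / (2 * n + 4)%:R) a (smooth_onM oo sJ sJ) ou
  (det_jacobian_sq_gt0 ou).
exact: D.
Qed.

(** Obtained by differentiating the transformation law of [scale] and using on both sides that
    [scale] is parallel; no second derivatives of the transition map appear. *)
Lemma pd_density u a : overlap i j u -> pd a rho u =
  rho u * (density_cov nabla i u a 0 - ((J u)^T *m density_cov nabla j (transition i j u)) a 0).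
Proof.
move=> ou; have oo := @overlap_open _ _ _ i j.
have iu := overlap_src ou; have ju := overlap_tgt ou.
have [_ E1] := is_derive_transition a (smooth_scale lc gm j) ou.
have di := is_derive_scale lc gm a iu.
have dr := derivableP (@derivable_density u a ou).
have [_ E2] := is_deriveM dr di.
have E : pd a (fun v => scale g j (transition i j v)) u = pd a (rho * scale g i) u.
  by apply: (pd_eq_on oo) => // v ov; exact: scale_transition.
move: E; rewrite /pd E1 E2.
under eq_bigr do rewrite (pd_scale lc gm)// scale_transition//.
move=> E; have s0 := scale_gt0 gm iu; have sn0 : scale g i u != 0 by rewrite gt_eqF.
apply: (mulIf sn0).
have W : ((J u)^T *m density_cov nabla j (transition i j u)) a 0 * rho u * scale g i u =
   - \sum_e jacobian_mx i j u e a *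
        - (density_cov nabla j (transition i j u) e 0 * (rho u * scale g i u)).
  rewrite mxE !mulr_suml -sumrN; apply: eq_bigr => e _.
  by rewrite mxE mulrN opprK !mulrA.
have {}E : 'D_(delta_mx 0 a) rho u * scale g i u =
    rho u * (density_cov nabla i u a 0 * scale g i u)
    - ((J u)^T *m density_cov nabla j (transition i j u)) a 0 * rho u * scale g i u.
  by rewrite W opprK E scalerN addNKr mulrC.
by rewrite E mulrBr mulrBl mulrA [rho u * (_ *m _) a 0]mulrC.
Qed.

(** The derivative of the density cocycle in the jet transition is exactly the failure of
    [density_cov] to be a 1-form, so the off-diagonal terms cancel. The identity is proved
    transposed, where the cotractor cocycle appears without its inverse. *)
Lemma frame_transition u : overlap i j u ->
  frame g nabla j (transition i j u) *m tractor_cocycle i j u =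
  cone_jacobian i j u *m frame g nabla i u.
Proof.
move=> ou; have uJ := jacobian_unit gm ou.
have uJT : (J u)^T \in unitmx by rewrite unitmx_tr.
have r0 : 0 < rho u by rewrite powR_gt0// det_jacobian_sq_gt0.
have uc : cotractor_cocycle i j u \in unitmx.
  rewrite unitmxE det_lblock unitrM -!unitmxE unitmxZ ?unitmx_inv ?uJT ?unitfE ?gt_eqF//.
  by rewrite andbT unitmxE det_scalar unitrX ?unitfE ?gt_eqF.
have key : (frame g nabla j (transition i j u))^T =
    cotractor_cocycle i j u *m (frame g nabla i u)^T *m (cone_jacobian i j u)^T.
  have ft c v : (frame g nabla c v)^T = scale g c v *: (unipotent (- density_cov nabla c v))^T.
    by rewrite linearZ.
  rewrite !ft scale_transition// -scalemxAr -scalemxAl mulrC -scalerA; congr (_ *: _).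
  rewrite !tr_block_mx !trmx0 !trmx1 !trmxK.
  rewrite !mulmx_block !(trmx0, trmx1, mul1mx, mulmx1, mul0mx, mulmx0, addr0, add0r).
  rewrite scale_block_mx scaler0 scale_scalar_mx mulr1.
  congr block_mx.
  - have -> : \col_a pd a (density_cocycle 1 i j) u =
        rho u *: (density_cov nabla i u - (J u)^T *m density_cov nabla j (transition i j u)).
      apply/matrixP => a x; rewrite mxE (ord1 x) scalemxE add_mxE oppmxE.
      exact: pd_density.
    rewrite -scalemxAl -scalemxAr -scalerDr; congr (_ *: _).
    rewrite mulmxBr mulmxA mulVmx// mul1mx mulmxN.
    by rewrite addrAC subrr add0r.
  - by rewrite -scalemxAl mulVmx.
apply: trmx_inj; rewrite /tractor_cocycle /dual_cocycle !trmx_mul trmxK key.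
by rewrite !mulmxA mulVmx// mul1mx.
Qed.

End FrameTransition.

(** * The tractor hyperkähler structure *)

Section TractorFields.
Variables (R : realType) (n : nat) (M : smooth_manifold R n.+1).
Variables (g : local_field M 'M[R]_n.+1) (nabla : connection_form M n.+1).
Hypothesis lc : is_levi_civita g nabla.
Hypothesis gm : is_metric g.

Notation tr_metric := (tractor_metric g nabla).
Notation tr_endo k := (tractor_endo nabla (cone_endo g nabla k)).

Lemma tractor_metric_bilinear : is_bilinear_field (@tractor_cocycle R n M) tr_metric.
Proof.
split=> [c|i j u ou]; first exact: smooth_tractor_metric.
set B := frame g nabla j (transition i j u); set t := tractor_cocycle i j u.
transitivity ((B *m t)^T *m cone_metric g j (transition i j u) *m (B *m t)).
  by rewrite trmx_mul !mulmxA.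
rewrite frame_transition// /tractor_metric -(cone_metric_transition gm ou).
by rewrite trmx_mul !mulmxA.
Qed.

Lemma tractor_endo_field k : is_killing g k ->
  is_endomorphism_field (@tractor_cocycle R n M) (tr_endo k).
Proof.
move=> kk; split=> [c|i j u ou].
  by apply: (smooth_tractor_endo lc); apply: (smooth_cone_endo lc gm); exact: (smooth_killing c kk).
have uj := frame_unit nabla gm (overlap_tgt ou).
rewrite -[LHS](mulKmx uj) -[RHS](mulKmx uj); congr (_ *m _).
have Ej := @frame_tractor_endo _ _ _ g nabla j (cone_endo g nabla k) (transition i j u).
have Ei := @frame_tractor_endo _ _ _ g nabla i (cone_endo g nabla k) u.
move: (tractor_endo _ _ j _) (tractor_endo _ _ i u) Ej Ei => Fj Fi Ej Ei.
rewrite mulmxA Ej -mulmxA (frame_transition lc gm ou) mulmxA.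
rewrite (cone_endo_transition lc gm kk.1 ou) -mulmxA -Ei mulmxA.
by rewrite -(frame_transition lc gm ou) mulmxA.
Qed.

Lemma tractor_metric_sym c u : chart_image c u -> (tr_metric c u)^T = tr_metric c u.
Proof.
move=> Uu; rewrite /tractor_metric !trmx_mul trmxK mulmxA; congr (_ *m _ *m _).
by rewrite tr_block_mx !trmx0 trmx1 (metric_tr gm Uu).
Qed.

Lemma tractor_metric_unit c u : chart_image c u -> tr_metric c u \in unitmx.
Proof.
move=> Uu; have uf := frame_unit nabla gm Uu.
rewrite /tractor_metric !unitmx_mul unitmx_tr uf /= andbT.
by rewrite unitmxE det_lblock det1 mul1r -unitmxE (metric_unit gm Uu).
Qed.

Lemma tractor_metric_signature c u p q : (0 < p)%N -> chart_image c u ->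
  has_signature (g c u) (4 * p - 1) (4 * q) ->
  has_signature (tr_metric c u) (4 * p) (4 * q).
Proof.
move=> p0 Uu [pq [B uB BgB]]; split; first by lia.
have uf := frame_unit nabla gm Uu.
have uB1 : block_mx (1%:M : 'M[R]_1) 0 0 B \in unitmx.
  by rewrite unitmxE det_lblock det1 mul1r -unitmxE.
(* In the frame the form is the cone metric, so [B] is extended by the radial unit vector, placed
   first. *)
exists (invmx (frame g nabla c u) *m block_mx (1%:M : 'M[R]_1) 0 0 B).
  by rewrite unitmx_mul unitmx_inv uf.
rewrite /tractor_metric trmx_mul !mulmxA mulmxK// trmx_inv.
rewrite -[_ *m invmx _ *m _]mulmxA mulVmx ?unitmx_tr// mulmx1.
rewrite tr_block_mx !mulmx_block.
rewrite !(trmx0, trmx1, mul1mx, mulmx1, mul0mx, mulmx0, addr0, add0r) BgB.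
apply/matrixP => x y.
case: (split_ordP x) => a ->; case: (split_ordP y) => b ->;
  rewrite ?(block_mxEul, block_mxEur, block_mxEdl, block_mxEdr) !mxE.
- by rewrite !ord1 eqxx; case: ifP => //=; lia.
- by rewrite eq_lrshift mulr0n.
- by rewrite eq_rlshift mulr0n.
(* The radial vector shifts the other indices by one; as [0 < p], the subtraction in [4 * p - 1] is
   not truncated and the positive directions number [4 * p]. *)
- rewrite eq_rshift; congr (_ *+ _); rewrite /= add1n.
  by have -> : (a.+1 < 4 * p)%N = (a < 4 * p - 1)%N by lia.
Qed.

Lemma tractor_endo_mul E F c u : 
  tractor_endo nabla E c u *m tractor_endo nabla F c u =
  tractor_endo nabla (fun i v => E i v *m F i v) c u.
Proof.
rewrite /tractor_endo !mulmxA; congr (_ *m _ *m _).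
by rewrite -(mulmxA (_ *m E c u)) unipotentVK mulmx1.
Qed.

Lemma tractor_endo_scalar E r c u : E c u = r%:M -> tractor_endo nabla E c u = r%:M.
Proof.
by rewrite /tractor_endo => ->; rewrite mul_mx_scalar -scalemxAl unipotentK scalemx1.
Qed.

Lemma tractor_endo_hermitian E c u :
  (E c u)^T *m cone_metric g c u *m E c u = cone_metric g c u ->
  (tractor_endo nabla E c u)^T *m tr_metric c u *m tractor_endo nabla E c u =
  tr_metric c u.
Proof.
move=> hE; have FE := @frame_tractor_endo _ _ _ g nabla c E u.
move: (tractor_endo _ _ _ _) FE => T FE; rewrite /tractor_metric -[in RHS]hE.
transitivity ((frame g nabla c u *m T)^T *m cone_metric g c u *m (frame g nabla c u *m T)).
  by rewrite trmx_mul !mulmxA.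
by rewrite FE trmx_mul !mulmxA.
Qed.

End TractorFields.

Theorem theorem3p1 (R : realType) (n p q : nat) (M : smooth_manifold R n.+1)
    (g : local_field M 'M[R]_n.+1) (nabla : connection_form M n.+1)
    (i j k : local_field M 'cV[R]_n.+1)
    (p_gt0 : (0 < p)%N)
    (nabla_lc : is_levi_civita g nabla)
    (gijk : is_3sasaki g nabla i j k)
    (g_sign : field_has_signature g (4 * p - 1) (4 * q)) :
  exists h I J K : local_field M 'M[R]_(1 + n.+1),
    [/\ is_tractor_metric h,
        parallel_bilinear (projective_class nabla) h &
        field_has_signature h (4 * p) (4 * q)] /\
    [/\ is_tractor_complex_structure I,
        is_tractor_complex_structure J &
        is_tractor_complex_structure K] /\
    [/\ parallel_endomorphism (projective_class nabla) I,
        parallel_endomorphism (projective_class nabla) J &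
        parallel_endomorphism (projective_class nabla) K] /\
    [/\ is_hermitian h I, is_hermitian h J & is_hermitian h K] /\
    (forall c u, chart_image c u -> I c u *m J c u *m K c u = - 1%:M).
Proof.
have gm : is_metric g := sasaki_metric (sasaki3_1 gijk).
have si := sasaki3_1 gijk; have sj := sasaki3_2 gijk; have sk := sasaki3_3 gijk.
(* The signature gives n + 1 = 4p + 4q - 1 >= 3, so the Schouten denominator is nonzero; this is
   read off at a point, where the signature is known. *)
have n_gt0 (c : chart M) u : chart_image c u -> (0 < n)%N.
  by move=> Uu; have [pq _] := g_sign c u Uu; lia.
have schE (c : chart M) u a b : chart_image c u -> schouten nabla c u a b = g c u a b.
  move=> Uu; apply: (schouten_einstein (n_gt0 c u Uu) (metric_tr gm Uu)).
  exact: (einstein nabla_lc gijk Uu).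
(* Parallelism is asked for every member of the projective class; this reduces it to the Levi-Civita
   connection. *)
have tform nabla' (c : chart M) u a : projective_class nabla nabla' -> chart_image c u ->
    tractor_form nabla' c u a = tractor_form nabla c u a.
  move=> [_ _ [ups ups_form pe]] Uu; have [_ tf _] := nabla_lc.
  rewrite /tractor_form /dual_form (cotractor_proj_change (n_gt0 c u Uu) tf
    (smooth_lc c nabla_lc) (ups_form.1 c) (pe c) a Uu).
  by [].
exists (tractor_metric g nabla), (tractor_endo nabla (cone_endo g nabla i)),
  (tractor_endo nabla (cone_endo g nabla j)), (tractor_endo nabla (cone_endo g nabla k)).
have neg1 : - 1%:M = (- 1)%:M :> 'M[R]_(1 + n.+1).
  by apply/matrixP => x y; rewrite !mxE mulNrn.
have cplx X : is_sasaki g nabla X ->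
    is_tractor_complex_structure (tractor_endo nabla (cone_endo g nabla X)).
  move=> sX; split; first exact: (tractor_endo_field nabla_lc gm (sasaki_killing sX)).
  move=> c u Uu; rewrite tractor_endo_mul neg1; apply: tractor_endo_scalar.
  by rewrite (cone_endo_sq nabla_lc gm sX Uu).
have par X : is_sasaki g nabla X -> parallel_endomorphism (projective_class nabla)
    (tractor_endo nabla (cone_endo g nabla X)).
  move=> sX nabla' cl c u a Uu; rewrite /nabla_endomorphism (tform nabla')//.
  apply: (tractor_endo_parallel nabla_lc gm) => //.
  - by move=> v a' b' Uv; exact: schE.
  - by apply: (smooth_cone_endo nabla_lc gm); exact: (smooth_killing c (sasaki_killing sX)).
  - exact: cone_endo_parallel.
have herm X : is_sasaki g nabla X -> is_hermitian (tractor_metric g nabla)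
    (tractor_endo nabla (cone_endo g nabla X)).
  move=> sX c u Uu; apply: tractor_endo_hermitian.
  exact: (cone_endo_hermitian nabla_lc gm sX Uu).
split; last split; last split; last split.
- split.
  + split; first exact: tractor_metric_bilinear.
    move=> c u Uu; split; first exact: tractor_metric_sym.
    exact: tractor_metric_unit.
  + move=> nabla' cl c u a Uu; rewrite /nabla_bilinear (tform nabla')//.
    apply: (tractor_metric_parallel nabla_lc gm) => //.
    by move=> v a' b' Uv; exact: schE.
  + by move=> c u Uu; apply: tractor_metric_signature => //; exact: g_sign.
- by split; exact: cplx.
- by split; exact: par.
- by split; exact: herm.
move=> c u Uu; rewrite !tractor_endo_mul neg1; apply: tractor_endo_scalar.
rewrite (cone_endo_mul nabla_lc gm si sj sk) ?(cone_endo_sq nabla_lc gm sk Uu)//.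
  by move=> v Uv; have [] := sasaki3_orthogonal gijk Uv.
by move=> v Uv; have [] := sasaki3_bracket gijk Uv.
Qed.
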